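(* Let $\xi(t)$, $t\in\mathbb{R}$, $\xi(0)=0$, be a self-similar process with stationary increments whose sample paths a.s. have only discontinuities of the first kind. Let $M=\sup\{\xi(s):s\in[0,1]\}$ and let $G$ be the leftmost position of $M$: $$G=\inf\{t\in[0,1]:\ \sup_{s\to t}\xi(s)=M\}.$$ Then: 1) $G$ has a continuous probability density $\psi(t)$ in $(0,1)$, and $$\psi(t)\le\psi(s)\max\Big(\frac{s}{t},\frac{1-s}{1-t}\Big)\qquad\forall\,t,s\in(0,1),$$ i.e., either $\psi\equiv 0$ or $\psi>0$ on $(0,1)$. 2) If $\psi\not\equiv 0$, then for $a\in(0,1)$ the position $G_T$ of the supremum of $\xi(t)$ in $(-Ta,\,T(1-a))$ satisfies $$P(|G_T|<1)=\frac{2\psi(a)}{T}\,(1+o(1)),\qquad T\to\infty.$$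
   Context: A process $\xi$ on $\mathbb{R}$ is self-similar if for some $h>0$ and every $\lambda>0$ the processes $\{\xi(\lambda t)\}$ and $\{\lambda^{h}\xi(t)\}$ have the same finite-dimensional distributions; it has stationary increments if for each fixed $c$ the processes $\{\xi(t+c)-\xi(c)\}$ and $\{\xi(t)-\xi(0)\}$ have the same finite-dimensional distributions. Discontinuities of the first kind: finite left and right limits exist at every point. The notation $\sup_{s\to t}\xi(s)=M$ means that the largest of the value at $t$ and the one-sided limits at $t$ (taken within the interval considered) equals the supremum $M$ over that interval. The (leftmost) position of the supremum over another interval is defined in the same way as $G$. That $G$ has density $\psi$ in $(0,1)$ means that the restriction of the law of $G$ to the open interval $(0,1)$ is absolutely continuous with density $\psi$; $G$ may also have mass at the endpoints, so $\psi\equiv 0$ is possible.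
   Formalization: The process ξ is additionally assumed separable in Doob's sense; without this the claim fails, e.g. for ξ(t)=1 at t=U and 0 elsewhere, with U a random variable having an arbitrary density on (0,1), where G=U. *)

(* Defs.v *)
From HB Require Import structures.
From mathcomp Require Import all_boot all_order all_algebra.
From mathcomp Require Import all_classical all_reals all_analysis.

Set Implicit Arguments.
Unset Strict Implicit.
Unset Printing Implicit Defensive.

Import Order.TTheory GRing.Theory Num.Theory.
Import numFieldNormedType.Exports.

Local Open Scope classical_set_scope.
Local Open Scope ring_scope.

Section Processes.
Context {d : measure_display} {Omega : measurableType d} {R : realType}.
Variable P : probability Omega R.

Definition same_fdd (X Y : R -> Omega -> R) : Prop :=
  forall (n : nat) (t : n.-tuple R) (B : set (n.-tuple R)), measurable B ->
    P [set w | B [tuple X (tnth t i) w | i < n]] =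
    P [set w | B [tuple Y (tnth t i) w | i < n]].

Definition self_similar (h : R) (X : R -> Omega -> R) : Prop :=
  forall lambda : R, 0 < lambda ->
    same_fdd (fun t w => X (lambda * t) w) (fun t w => lambda `^ h * X t w).

Definition stationary_increments (X : R -> Omega -> R) : Prop :=
  forall c : R,
    same_fdd (fun t w => X (t + c) w - X c w) (fun t w => X t w - X 0 w).

(* Separability in the sense of Doob.  Finite-dimensional distributions do not
   see the values of a path at random times, so without it they determine
   neither the supremum over an interval nor its position: if U has a density,
   the process equal to 1 at time U and to 0 elsewhere has the
   finite-dimensional distributions of the zero process. *)
Definition separable_process (X : R -> Omega -> R) : Prop :=
  exists2 S : set R, countable S &
    {ae P, forall w, forall t : R, exists s : nat -> R,
      [/\ forall n, S (s n), s @ \oo --> t & X (s n) w @[n --> \oo] --> X t w]}.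

End Processes.

Section Paths.
Context {R : realType}.

Definition first_kind_discontinuities (f : R -> R) : Prop :=
  forall t : R, cvg (f @ t^'-) /\ cvg (f @ t^'+).

(* The value at t and the one-sided limits at t, taken within the interval I;
   t is in I or is an endpoint of I, so the one-sided limit on a given side
   makes sense within I exactly when I has points on that side of t. *)
Definition local_values (I : set R) (f : R -> R) (t : R) : set R :=
  [set y | [\/ I t /\ y = f t,
               (exists2 s, I s & s < t) /\ f @ t^'- --> y |
               (exists2 s, I s & t < s) /\ f @ t^'+ --> y]].

(* "sup_{s -> t} f(s) = M": M is the largest of the local values at t. *)
Definition local_sup_eq (I : set R) (f : R -> R) (t M : R) : Prop :=
  local_values I f t M /\ ubound (local_values I f t) M.

(* The position ranges over the closure of I, because the supremum over an
   open interval may be approached only at an endpoint. *)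
Definition leftmost_sup_position (I : set R) (f : R -> R) : R :=
  inf [set t | closure I t /\ local_sup_eq I f t (sup (f @` I))].

End Paths.

(* Main.v *)
Require Import Defs.
From HB Require Import structures.
From mathcomp Require Import all_boot all_order all_algebra.
From mathcomp Require Import all_classical all_reals all_analysis.
From mathcomp Require Import measurable_realfun ring lra.

Set Implicit Arguments.
Unset Strict Implicit.
Unset Printing Implicit Defensive.

Import Order.TTheory GRing.Theory Num.Theory.
Import numFieldNormedType.Exports.

Local Open Scope classical_set_scope.
Local Open Scope ring_scope.

(** Write H x for the probability that the supremum over an interval of length
    L starting at a is already reached on its part of relative length x, with
    0 < x < 1.  Stationarity of the increments moves the interval to the origin,
    self-similarity rescales it to unit length, and the event does not change
    when a path is shifted or multiplied by a positive constant; so H depends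
    neither on a nor on L.  Everything follows from comparing an interval with a
    subinterval: if the supremum over [0,1] is first reached between x and y,
    and (c, c + L) is contained in [0,1] and contains [x, y], then the supremum
    over (c, c + L) is first reached between x and y as well.  Hence
      H y - H x <= H ((y - c) / L) - H ((x - c) / L).
    Choosing c and L so that a small interval at s is carried to a small
    interval at t shows, heuristically, that a density psi of H must satisfy
    L * psi t <= psi s for L the smaller of t / s and (1 - t) / (1 - s), which
    is the announced inequality.

    To obtain psi, an interval J and an interval K are cut into equal pieces
    that are compared one by one ([slope_le]).  This bounds the slope of H on J
    by the slope on K times an explicit ratio which tends to 1 when J and K
    shrink to the same point.  So, for each t, the slopes of H near t are
    squeezed to one number [limit_slope] ([limit_slope_ge], [limit_slope_le]),
    which is a continuous function of t, is the derivative of H, and satisfies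
    the inequality ([limit_slope_ratio]).  By the fundamental theorem of
    calculus it is the density of the law of G on (0,1) ([position_density]).
    The position over (-T a, T (1 - a)) is at distance less than 1 from 0 when
    the relative position is within 1 / T of a, which for large T has probability
    H (a + 1/T) - H (a - 1/T); dividing by 2 / T gives psi a in the limit
    ([cvg_symmetric_slope]).

    The remaining work links paths with finite-dimensional distributions.  The
    events above are expressed through the values of the path at countably many
    points, whose joint law is determined by the finite-dimensional
    distributions ([same_fdd_sequence]).  For this to describe the whole path,
    the value at each time must be one of the two one-sided limits there.
    Almost all paths are of this kind ([ae_regular_path]): self-similarity and
    stationarity make the increment over a time l have the law of l^h times a
    fixed variable, so the path is almost surely continuous at each fixed time,
    in particular at all times of the countable separating set simultaneously.
    For such paths the random variable built from the countable events is the
    leftmost position of the supremum ([leftmost_sup_position_regular]). *)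

(** * Functions whose increments scale on the unit interval *)

Section ScalingIncrements.
Variables (R : realType) (H : R -> R).

(** The map u |-> t + L * (u - s) carries [s, s + r] to [t, t + L * r]; the last
    two conditions say that it carries [0,1] into itself. *)
Definition scaling_increments := forall L s t r : R,
  0 < L -> 0 < s -> 0 <= r -> s + r < 1 -> L * s <= t -> L * (1 - s) <= 1 - t ->
  H (t + L * r) - H t <= H (s + r) - H s.

Hypothesis H_nd : {in `]0, 1[ &, {homo H : x y / x <= y}}.
Hypothesis H_scal : scaling_increments.

Lemma piece_increment (L x x' y y' p q u v : R) :
  0 < L -> 0 < x -> x' < 1 -> 0 < y -> y' < 1 ->
  L * y' <= x -> L * (1 - y) <= 1 - x' ->
  0 <= p -> 0 <= u -> x + p + u <= x' ->
  0 <= q -> 0 <= v -> y + q + v <= y' -> u <= L * v ->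
  H (x + p + u) - H (x + p) <= H (y + q + v) - H (y + q).
Proof.
move=> L0 x0 x'1 y0 y'1 Ly'x Lyx' p0 u0 pux' q0 v0 qvy' uLv.
have Lq1 : L * (y + q) <= L * y' by rewrite ler_pM2l//; lra.
have Lq2 : L * (1 - (y + q)) <= L * (1 - y) by rewrite ler_pM2l//; lra.
have Lv0 : 0 <= L * v by rewrite mulr_ge0// ltW.
have Lv1 : 0 < L * (1 - (y + q)) - L * v by rewrite -mulrBr mulr_gt0//; lra.
have t1 : x + p + L * v < 1 by move: (L * (1 - (y + q))) Lv1 Lq2 => z; lra.
apply: (@le_trans _ _ (H (x + p + L * v) - H (x + p))).
  rewrite lerD2r; apply: H_nd; rewrite ?in_itv/= ?lerD2l//.
  - by apply/andP; split; lra.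
  - by apply/andP; split; lra.
by apply: H_scal => //; lra.
Qed.

Lemma sum_increments (x u : R) (m : nat) :
  \sum_(0 <= i < m) (H (x + i.+1%:R * u) - H (x + i%:R * u)) =
  H (x + m%:R * u) - H x.
Proof. by rewrite (telescope_sumr (fun i => H (x + i%:R * u)))// mul0r addr0. Qed.

(** Each of the m pieces of [x, x'] has an increment at most that of each of the
    n pieces of [y, y'], because the latter, shrunk by L, are at least as long;
    the inequality is the sum over all m * n pairs of pieces. *)
Lemma subdivided_increments (L x x' y y' : R) (m n : nat) :
  0 < L -> 0 < x -> x <= x' -> x' < 1 -> 0 < y -> y <= y' -> y' < 1 ->
  L * y' <= x -> L * (1 - y) <= 1 - x' -> (0 < m)%N -> (0 < n)%N ->
  (x' - x) / m%:R <= L * ((y' - y) / n%:R) ->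
  n%:R * (H x' - H x) <= m%:R * (H y' - H y).
Proof.
move=> L0 x0 xx' x'1 y0 yy' y'1 Ly'x Lyx' m0 n0 uv.
have m0R : 0 < m%:R :> R by rewrite ltr0n.
have n0R : 0 < n%:R :> R by rewrite ltr0n.
set u := (x' - x) / m%:R in uv; set v := (y' - y) / n%:R in uv.
have u0 : 0 <= u by rewrite divr_ge0 ?subr_ge0// ltW.
have v0 : 0 <= v by rewrite divr_ge0 ?subr_ge0// ltW.
have Ex' : x' = x + m%:R * u by rewrite /u; field; rewrite gt_eqF.
have Ey' : y' = y + n%:R * v by rewrite /v; field; rewrite gt_eqF.
have piece i j : (i < m)%N -> (j < n)%N ->
    H (x + i.+1%:R * u) - H (x + i%:R * u) <=
    H (y + j.+1%:R * v) - H (y + j%:R * v).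
  move=> im jn.
  rewrite -(@natr1 R i) -(@natr1 R j) !mulrDl !mul1r !addrA.
  apply: (@piece_increment L x x' y y') => //.
  - by rewrite mulr_ge0.
  - rewrite -addrA Ex' lerD2l -[X in _ + X]mul1r -mulrDl natr1.
    by rewrite ler_wpM2r// ler_nat.
  - by rewrite mulr_ge0.
  - rewrite -addrA Ey' lerD2l -[X in _ + X]mul1r -mulrDl natr1.
    by rewrite ler_wpM2r// ler_nat.
have -> : n%:R * (H x' - H x) = \sum_(0 <= j < n) \sum_(0 <= i < m)
    (H (x + i.+1%:R * u) - H (x + i%:R * u)).
  by rewrite sum_increments -Ex' sumr_const_nat subn0 mulr_natl.
have -> : m%:R * (H y' - H y) = \sum_(0 <= j < n) \sum_(0 <= i < m)
    (H (y + j.+1%:R * v) - H (y + j%:R * v)).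
  rewrite exchange_big/= sum_increments -Ey'.
  by rewrite sumr_const_nat subn0 mulr_natl.
apply: ler_sum_nat => j /andP[_ jn]; apply: ler_sum_nat => i /andP[_ im].
exact: piece.
Qed.

Definition slope (x x' : R) := (H x' - H x) / (x' - x).

Lemma slope_ge0 (x x' : R) : 0 < x -> x < x' -> x' < 1 -> 0 <= slope x x'.
Proof.
move=> x0 xx' x'1; rewrite divr_ge0// subr_ge0 ?(ltW xx')//.
by apply: H_nd; rewrite ?in_itv/= ?(ltW xx')//; lra.
Qed.

(** This is [subdivided_increments] with the ratio m / n chosen as close as
    desired to the ratio of lengths that it allows. *)
Lemma slope_le (L x x' y y' : R) :
  0 < L -> 0 < x -> x < x' -> x' < 1 -> 0 < y -> y < y' -> y' < 1 ->
  L * y' <= x -> L * (1 - y) <= 1 - x' -> L * slope x x' <= slope y y'.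
Proof.
move=> L0 x0 xx' x'1 y0 yy' y'1 Ly'x Lyx'.
have a0 : 0 < x' - x by rewrite subr_gt0.
have b0 : 0 < y' - y by rewrite subr_gt0.
have Sy0 := slope_ge0 y0 yy' y'1.
have Dy0 : 0 <= H y' - H y.
  by rewrite subr_ge0; apply: H_nd; rewrite ?in_itv/= ?(ltW yy')//; lra.
pose r := (x' - x) / (L * (y' - y)).
have r0 : 0 < r by rewrite divr_gt0// mulr_gt0.
suff main : H x' - H x <= r * (H y' - H y).
  rewrite /slope ler_pdivlMr//.
  have -> : L * ((H x' - H x) / (x' - x)) * (y' - y) = (H x' - H x) / r.
    by rewrite /r; field; rewrite !gt_eqF.
  by rewrite ler_pdivrMr// mulrC.
apply/ler_addgt0Pr => e e0.
pose D := H y' - H y.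
(* m exceeds n * r by at most 1, which costs at most D / n; n makes this <= e. *)
pose n := (Num.truncn (D / e)).+1.
have n0R : 0 < n%:R :> R by rewrite ltr0n.
have nD : D <= n%:R * e.
  by rewrite -ler_pdivrMr// ltW// /n truncnS_gt.
pose m := (Num.truncn (n%:R * r)).+1.
have mr : n%:R * r < m%:R by rewrite /m truncnS_gt.
have mr' : m%:R <= n%:R * r + 1.
  by rewrite /m -natr1 lerD2r; rewrite truncn_le mulr_ge0// ltW.
have := @subdivided_increments L x x' y y' m n L0 x0 (ltW xx') x'1 y0 (ltW yy') y'1
  Ly'x Lyx' isT isT.
have m0R : 0 < m%:R :> R by rewrite ltr0n.
have -> : (x' - x) / m%:R <= L * ((y' - y) / n%:R).
  rewrite ler_pdivrMr//.
  have -> : x' - x = L * ((y' - y) / n%:R) * (n%:R * r).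
    by rewrite /r; field; rewrite !gt_eqF.
  by rewrite ler_pM2l ?(ltW mr)// mulr_gt0// divr_gt0.
move=> /(_ isT) nm.
rewrite -(ler_pM2l n0R); apply: (le_trans nm).
apply: (@le_trans _ _ ((n%:R * r + 1) * D)); first exact: ler_wpM2r.
have -> : (n%:R * r + 1) * D = n%:R * (r * D) + D by ring.
by rewrite [X in _ <= X]mulrDr lerD2l.
Qed.

(** For J = [x, x'], [shrink] is the largest L such that maps of ratio L which
    preserve [0,1] can carry t to every point of J, and [stretch] is the inverse
    of the largest L such that they can carry every point of J to t; both tend
    to 1 when J shrinks to t. *)
Definition shrink (x x' t : R) := Num.min (x / t) ((1 - x') / (1 - t)).
Definition stretch (x x' t : R) := Num.max (x' / t) ((1 - x) / (1 - t)).

(** A supremum is always defined, so the density needs no convergence argument;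
    [slope_sandwich] shows that it is squeezed between the slopes near t. *)
Definition limit_slope (t : R) := sup [set v | exists x x', [/\ 0 < x, x < x', x' < 1 &
  v = slope x x' * shrink x x' t]].

Lemma shrink_gt0 (x x' t : R) : 0 < x -> x' < 1 -> 0 < t -> t < 1 ->
  0 < shrink x x' t.
Proof. by move=> *; rewrite lt_min !divr_gt0 ?subr_gt0. Qed.

Lemma stretch_gt0 (x x' t : R) : x < 1 -> 0 < t -> t < 1 ->
  0 < stretch x x' t.
Proof. by move=> *; rewrite lt_max orbC divr_gt0 ?subr_gt0. Qed.

(** Apply [slope_le] with L the quotient of [shrink] by [stretch]: the point t
    cancels out. *)
Lemma slope_sandwich (x x' y y' t : R) : 0 < t -> t < 1 ->
  0 < x -> x < x' -> x' < 1 -> 0 < y -> y < y' -> y' < 1 ->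
  slope x x' * shrink x x' t <= slope y y' * stretch y y' t.
Proof.
move=> t0 t1 x0 xx' x'1 y0 yy' y'1.
have m0 := shrink_gt0 x0 x'1 t0 t1.
have M0 := stretch_gt0 y' (lt_trans yy' y'1) t0 t1.
rewrite -ler_pdivrMr//.
have -> : slope x x' * shrink x x' t / stretch y y' t =
  shrink x x' t / stretch y y' t * slope x x' by ring.
have t1' : 0 < 1 - t by rewrite subr_gt0.
apply: slope_le => //; first exact: divr_gt0.
- rewrite mulrAC ler_pdivrMr//.
  apply: (@le_trans _ _ (x / t * y')).
    by apply: ler_wpM2r; [lra|rewrite ge_min lexx].
  by rewrite mulrAC -mulrA ler_pM2l// le_max lexx.
- rewrite mulrAC ler_pdivrMr//.
  apply: (@le_trans _ _ ((1 - x') / (1 - t) * (1 - y))).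
    by apply: ler_wpM2r; [lra|rewrite ge_min lexx orbT].
  by rewrite mulrAC -mulrA ler_pM2l ?subr_gt0// le_max lexx orbT.
Qed.

Lemma limit_slope_le (y y' t : R) : 0 < t -> t < 1 -> 0 < y -> y < y' -> y' < 1 ->
  limit_slope t <= slope y y' * stretch y y' t.
Proof.
move=> t0 t1 y0 yy' y'1; apply: ge_sup.
  by exists (slope y y' * shrink y y' t), y, y'.
by move=> _ [x [x' [x0 xx' x'1 ->]]]; exact: slope_sandwich.
Qed.

Lemma limit_slope_ge (x x' t : R) : 0 < t -> t < 1 -> 0 < x -> x < x' -> x' < 1 ->
  slope x x' * shrink x x' t <= limit_slope t.
Proof.
move=> t0 t1 x0 xx' x'1; apply: ub_le_sup; last by exists x, x'.
exists (slope x x' * stretch x x' t) => _ [y [y' [y0 yy' y'1 ->]]].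
exact: slope_sandwich.
Qed.

Lemma limit_slope_ge0 (t : R) : 0 < t -> t < 1 -> 0 <= limit_slope t.
Proof.
move=> t0 t1; apply: le_trans (limit_slope_ge t0 t1 t0 (_ : t < (1 + t) / 2) _);
  [|lra..].
apply: mulr_ge0; first by apply: slope_ge0; lra.
by apply: ltW; apply: shrink_gt0; lra.
Qed.

(** Changing s into t multiplies [shrink x x'] by at most the last factor, and
    this passes to the supremum. *)
Lemma limit_slope_ratio (t s : R) : 0 < t -> t < 1 -> 0 < s -> s < 1 ->
  limit_slope t <= limit_slope s * Num.max (s / t) ((1 - s) / (1 - t)).
Proof.
move=> t0 t1 s0 s1; have psi0 := limit_slope_ge0 s0 s1.
have t1' : 0 < 1 - t by rewrite subr_gt0.
have s1' : 0 < 1 - s by rewrite subr_gt0.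
apply: ge_sup.
  by exists (slope t ((1 + t) / 2) * shrink t ((1 + t) / 2) t), t, ((1 + t) / 2);
     split => //; lra.
move=> _ [x [x' [x0 xx' x'1 ->]]].
set M := Num.max _ _.
have M0 : 0 < M by rewrite lt_max divr_gt0.
apply: le_trans (ler_wpM2r (ltW M0) (limit_slope_ge s0 s1 x0 xx' x'1)).
rewrite -[X in _ <= X]mulrA; apply: ler_wpM2l; first exact: slope_ge0.
have sM : s / t <= M by rewrite le_max lexx.
have s'M : (1 - s) / (1 - t) <= M by rewrite le_max lexx orbT.
rewrite /shrink minr_pMl ?(ltW M0)// le_min; apply/andP; split.
- rewrite ge_min; apply/orP; left.
  have -> : x / t = x / s * (s / t) by field; rewrite !gt_eqF.
  by rewrite ler_wpM2l// divr_ge0// ltW.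
- rewrite ge_min; apply/orP; right.
  have -> : (1 - x') / (1 - t) = (1 - x') / (1 - s) * ((1 - s) / (1 - t)).
    by field; rewrite !gt_eqF.
  by rewrite ler_wpM2l// divr_ge0 ?subr_ge0// ltW.
Qed.

(** The rate at which [shrink] and [stretch] of an interval of radius r around t
    move away from 1. *)
Definition steepness (t : R) := Num.max t^-1 (1 - t)^-1.

Lemma steepness_gt0 (t : R) : 0 < t -> 0 < steepness t.
Proof. by move=> t0; rewrite lt_max invr_gt0 t0. Qed.

Lemma stretch_near (x x' t r : R) : 0 < t -> t < 1 -> 0 <= r ->
  t - r <= x -> x' <= t + r -> stretch x x' t <= 1 + r * steepness t.
Proof.
move=> t0 t1 r0 tx xt; have t1' : 0 < 1 - t by rewrite subr_gt0.
have k1 : r * t^-1 <= r * steepness t by rewrite ler_wpM2l// le_max lexx.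
have k2 : r * (1 - t)^-1 <= r * steepness t.
  by rewrite ler_wpM2l// le_max lexx orbT.
rewrite ge_max; apply/andP; split.
- apply: (@le_trans _ _ (1 + r * t^-1)); last by rewrite lerD2l.
  by rewrite ler_pdivrMr// mulrDl mul1r divfK ?gt_eqF.
- apply: (@le_trans _ _ (1 + r * (1 - t)^-1)); last by rewrite lerD2l.
  by rewrite ler_pdivrMr// mulrDl mul1r divfK ?gt_eqF//; lra.
Qed.

Lemma shrink_near (x x' t r : R) : 0 < t -> t < 1 -> 0 <= r ->
  t - r <= x -> x' <= t + r -> 1 - r * steepness t <= shrink x x' t.
Proof.
move=> t0 t1 r0 tx xt; have t1' : 0 < 1 - t by rewrite subr_gt0.
have k1 : r * t^-1 <= r * steepness t by rewrite ler_wpM2l// le_max lexx.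
have k2 : r * (1 - t)^-1 <= r * steepness t.
  by rewrite ler_wpM2l// le_max lexx orbT.
rewrite le_min; apply/andP; split.
- apply: (@le_trans _ _ (1 - r * t^-1)); first by rewrite lerB.
  by rewrite ler_pdivlMr// mulrBl mul1r divfK ?gt_eqF.
- apply: (@le_trans _ _ (1 - r * (1 - t)^-1)); first by rewrite lerB.
  by rewrite ler_pdivlMr// mulrBl mul1r divfK ?gt_eqF//; lra.
Qed.

Lemma close_of_ratio (p q k : R) : 0 <= p -> 0 <= q -> 0 <= k -> k <= 2^-1 ->
  p <= q * (1 + k) -> q * (1 - k) <= p -> `|q - p| <= 2 * k * p.
Proof.
move=> p0 q0 k0 k2 pq qp.
have q2 : q <= 2 * p.
  suff : q * 2^-1 <= q * (1 - k) by lra.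
  by apply: ler_wpM2l => //; lra.
have qk : q * k <= 2 * p * k by exact: ler_wpM2r.
by rewrite ler_norml; apply/andP; split; lra.
Qed.

(** The quantitative form of the squeeze from which all the limits below are
    derived. *)
Lemma slope_near (t r x x' : R) : 0 < t -> t < 1 -> 0 <= r ->
  r * steepness t <= 2^-1 -> 0 < x -> x < x' -> x' < 1 ->
  t - r <= x -> x' <= t + r ->
  `|slope x x' - limit_slope t| <= 2 * (r * steepness t) * limit_slope t.
Proof.
move=> t0 t1 r0 rk x0 xx' x'1 tx xt.
have S0 := slope_ge0 x0 xx' x'1.
apply: close_of_ratio => //.
- exact: limit_slope_ge0.
- by rewrite mulr_ge0// ltW// steepness_gt0.
- apply: le_trans (limit_slope_le t0 t1 x0 xx' x'1) _.
  by apply: ler_wpM2l => //; exact: stretch_near.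
- apply: le_trans (limit_slope_ge t0 t1 x0 xx' x'1).
  by apply: ler_wpM2l => //; exact: shrink_near.
Qed.

(** [limit_slope s] obeys the same two bounds as the slopes near t, with the
    point interval [s, s], by [limit_slope_ratio] in both directions. *)
Lemma limit_slope_near (t s : R) : 0 < t -> t < 1 -> 0 < s -> s < 1 ->
  `|s - t| * steepness t <= 2^-1 ->
  `|limit_slope s - limit_slope t| <=
  2 * (`|s - t| * steepness t) * limit_slope t.
Proof.
move=> t0 t1 s0 s1 rk.
have t1' : 0 < 1 - t by rewrite subr_gt0.
have s1' : 0 < 1 - s by rewrite subr_gt0.
have : `|s - t| <= `|s - t| by [].
rewrite ler_distl => /andP[st ts].
apply: close_of_ratio => //; try exact: limit_slope_ge0.
- by rewrite mulr_ge0// ltW// steepness_gt0.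
- apply: le_trans (limit_slope_ratio t0 t1 s0 s1) _.
  apply: ler_wpM2l; first exact: limit_slope_ge0.
  exact: (@stretch_near s s t).
- apply: (@le_trans _ _ (limit_slope s * shrink s s t)).
    apply: ler_wpM2l; first exact: limit_slope_ge0.
    exact: shrink_near.
  rewrite -ler_pdivlMr; last exact: shrink_gt0.
  apply: le_trans (limit_slope_ratio s0 s1 t0 t1) _.
  apply: ler_wpM2l; first exact: limit_slope_ge0.
  have m0 := @shrink_gt0 s s t s0 s1 t0 t1.
  rewrite ge_max; apply/andP; split.
    by rewrite -[t / s]invf_div lef_pV2 ?posrE ?divr_gt0// ge_min lexx.
  rewrite -[_ / (1 - s)]invf_div lef_pV2 ?posrE ?divr_gt0//.
  by rewrite ge_min lexx orbT.
Qed.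

Lemma cvg_dist_le (T : Type) (F : set_system T) {FF : Filter F} (g u : T -> R) (l : R) :
  (\forall x \near F, `|g x - l| <= u x) -> u @ F --> 0 -> g @ F --> l.
Proof.
move=> gu u0; apply/cvgrPdist_lt => e e0.
move/cvgrPdist_lt : u0 => /(_ _ e0); rewrite near_map => u0; near=> x.
rewrite distrC; apply: (@le_lt_trans _ _ (u x)); first by near: x.
apply: (@le_lt_trans _ _ `|0 - u x|); last by near: x.
by rewrite sub0r normrN ler_norm.
Unshelve. all: by end_near. Qed.

Lemma cvg_steepness (t c : R) : (2 * (r * steepness t) * c) @[r --> 0] --> 0.
Proof.
rewrite -[X in _ --> X](_ : 2 * (0 * steepness t) * c = 0); last first.
  by rewrite mul0r mulr0 mul0r.
apply: cvgM; last exact: cvg_cst.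
by apply: cvgM; [exact: cvg_cst|apply: cvgM; [exact: cvg_id|exact: cvg_cst]].
Qed.

Lemma limit_slope_continuous : {in `]0, 1[, continuous limit_slope}.
Proof.
move=> t; rewrite in_itv/= => /andP[t0 t1].
have k0 := steepness_gt0 t0.
apply: (@cvg_dist_le _ _ _ _
  (fun s => 2 * (`|s - t| * steepness t) * limit_slope t)).
  near=> s; apply: limit_slope_near => //.
  - by near: s; exact: lt_nbhsr.
  - by near: s; exact: lt_nbhsl.
  - rewrite -ler_pdivlMr// distrC; near: s.
    by apply: cvgr_dist_le; [exact: cvg_id|rewrite divr_gt0].
have cn : `|s - t| @[s --> t] --> 0.
  rewrite -[X in _ --> X](_ : `|t - t| = 0); last by rewrite subrr normr0.
  by apply: cvg_norm; apply: cvgB; [exact: cvg_id|exact: cvg_cst].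
exact: (cvg_comp _ _ cn (cvg_steepness t (limit_slope t))).
Unshelve. all: by end_near. Qed.

Lemma is_derive_limit_slope (t : R) : 0 < t -> t < 1 ->
  is_derive t 1 H (limit_slope t).
Proof.
move=> t0 t1; have k0 := steepness_gt0 t0.
have main : h^-1 *: (H (h *: 1 + t) - H t) @[h --> 0^'] --> limit_slope t.
  apply: (@cvg_dist_le _ _ _ _
    (fun h => 2 * (`|h| * steepness t) * limit_slope t)).
    near=> h; rewrite /GRing.scale/= mulr1.
    have hk : `|h| * steepness t <= 2^-1.
      rewrite -ler_pdivlMr//; near: h.
      by apply: dnbhs0_le; rewrite divr_gt0.
    have ht : `|h| < t by near: h; exact: dnbhs0_lt.
    have ht' : `|h| < 1 - t by near: h; apply: dnbhs0_lt; rewrite subr_gt0.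
    have h_neq0 : h != 0 by near: h; exact: nbhs_dnbhs_neq.
    have := lexx `|h|; rewrite ler_norml => /andP[h1 h2].
    have [h0|h0] := ltP 0 h.
      have -> : h^-1 * (H (h + t) - H t) = slope t (h + t).
        by rewrite /slope addrK mulrC.
      by apply: slope_near => //; lra.
    have {}h0 : h < 0 by rewrite lt_neqAle h_neq0.
    have -> : h^-1 * (H (h + t) - H t) = slope (h + t) t.
      have -> : H (h + t) - H t = - (H t - H (h + t)) by rewrite opprB.
      have E : t - (h + t) = - h by ring.
      by rewrite /slope E invrN !mulrN mulrC.
    by apply: slope_near => //; lra.
  have cn : `|h| @[h --> (0 : R)^'] --> 0.
    have := @norm_continuous _ R 0; rewrite /continuous_at normr0.
    exact: cvg_within_filter.
  exact: (cvg_comp _ _ cn (cvg_steepness t (limit_slope t))).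
apply: DeriveDef; first by apply/cvg_ex; exists (limit_slope t).
exact: cvg_lim.
Unshelve. all: by end_near. Qed.

Lemma cvg_symmetric_slope (t : R) : 0 < t -> t < 1 ->
  slope (t - r) (t + r) @[r --> 0^'+] --> limit_slope t.
Proof.
move=> t0 t1; have k0 := steepness_gt0 t0.
apply: (@cvg_dist_le _ _ _ _ (fun r => 2 * (r * steepness t) * limit_slope t)).
  near=> r.
  have r0 : 0 < r by [].
  have rk : r * steepness t <= 2^-1.
    rewrite -ler_pdivlMr//; near: r; apply: nbhs_right_le.
    by rewrite divr_gt0.
  have rt : r < t by near: r; exact: nbhs_right_lt.
  have rt' : r < 1 - t by near: r; apply: nbhs_right_lt; rewrite subr_gt0.
  by apply: slope_near => //; lra.
by apply: cvg_within_filter; exact: cvg_steepness.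
Unshelve. all: by end_near. Qed.

Lemma scaling_continuous (t : R) : 0 < t -> t < 1 -> {for t, continuous H}.
Proof.
move=> t0 t1; apply: differentiable_continuous; apply/derivable1_diffP.
by have [] := is_derive_limit_slope t0 t1.
Qed.

Lemma integral_limit_slope (x y : R) : 0 < x -> x < y -> y < 1 ->
  (\int[lebesgue_measure]_(t in `]x, y]) (limit_slope t)%:E =
   (H y)%:E - (H x)%:E)%E.
Proof.
move=> x0 xy y1.
have sub z : x <= z -> z <= y -> z \in `]0, 1[.
  by move=> xz zy; rewrite in_itv/= (lt_le_trans x0)// (le_lt_trans zy).
have cpsi : {within `[x, y], continuous limit_slope}.
  apply: continuous_in_subspaceT => z; rewrite inE/= in_itv/= => /andP[xz zy].
  by apply: limit_slope_continuous; exact: sub.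
rewrite integral_itv_obnd_cbnd; last first.
  apply/measurable_EFinP; apply: (measurable_funS (E := `[x, y]%classic)) => //.
    by apply: subset_itvr; rewrite bnd_simp.
  exact: subspace_continuous_measurable_fun.
apply: continuous_FTC2 => //.
  split.
  - move=> z; rewrite in_itv/= => /andP[xz zy].
    have [z0 z1] : 0 < z /\ z < 1 by split; lra.
    by have [] := is_derive_limit_slope z0 z1.
  - by apply: cvg_at_right_filter; apply: scaling_continuous; lra.
  - by apply: cvg_at_left_filter; apply: scaling_continuous; lra.
move=> z; rewrite in_itv/= => /andP[xz zy]; rewrite derive1E.
by apply: derive_val; apply: is_derive_limit_slope; lra.
Qed.

End ScalingIncrements.

(** * The part of an interval where the supremum of a path is reached *)

Section Paths.
Variable R : realType.
Implicit Types (f : R -> R) (v : nat -> R).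

(** The paths that are determined, as far as suprema are concerned, by their
    values on any dense set. *)
Definition regular_path f :=
  first_kind_discontinuities f /\
  forall t, f @ t^'- --> f t \/ f @ t^'+ --> f t.

(** For a bounded f this says that the supremum of f over (a, q) equals the
    supremum over (a, b); the formulation without suprema needs no boundedness
    and is visibly invariant under positive affine maps of the values. *)
Definition sup_before f (a q b : R) := forall s, a < s -> s < b ->
  forall e, 0 < e -> exists s', [/\ a < s', s' < q & f s < f s' + e].

Lemma sup_before_le f (a p q b : R) : p <= q ->
  sup_before f a p b -> sup_before f a q b.
Proof.
move=> pq fp s sa sb e e0; have [s' [s'a s'p ?]] := fp s sa sb e e0.
by exists s'; split => //; exact: lt_le_trans pq.
Qed.

Lemma not_sup_before f (a q b : R) : ~ sup_before f a q b ->
  exists s e, [/\ a < s, s < b, 0 < e &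
    forall s', a < s' -> s' < q -> f s' + e <= f s].
Proof.
move=> /existsNP[s] /not_implyP[sa] /not_implyP[sb] /existsNP[e].
move=> /not_implyP[e0] /forallNP H; exists s, e; split => // s' s'a s'q.
by rewrite leNgt; apply/negP => fs; apply: (H s').
Qed.

(** The supremum over (a, b) exceeds all values on (a, x) by some e0 and is
    approached on (a, y), hence on [x, y), which lies in every (a', b')
    considered; there it dominates (a', b') and strictly exceeds (a', x). *)
Lemma sup_before_subinterval f (a b a' b' x y : R) :
  a <= a' -> a' < x -> x <= y -> y < b' -> b' <= b ->
  sup_before f a y b -> ~ sup_before f a x b ->
  sup_before f a' y b' /\ ~ sup_before f a' x b'.
Proof.
move=> aa' a'x xy yb' b'b fy /not_sup_before[s0 [e0 [s0a s0b e00 H]]].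
have key s e : a < s -> s < b -> f s0 <= f s -> 0 < e -> exists s',
    [/\ x <= s', s' < y & f s < f s' + e].
  move=> sa sb s0s e_gt0.
  have m0 : 0 < Num.min e e0 by rewrite lt_min e_gt0.
  have [s' [s'a s'y fs']] := fy s sa sb _ m0.
  have me : Num.min e e0 <= e by rewrite ge_min lexx.
  have me0 : Num.min e e0 <= e0 by rewrite ge_min lexx orbT.
  exists s'; split => //; last by lra.
  rewrite leNgt; apply/negP => s'x.
  by have := H s' s'a s'x; lra.
split.
- move=> s sa' sb' e e_gt0.
  have [s0s|ss0] := leP (f s0) (f s).
    have [||s' [xs' s'y fs]] := key s e _ _ s0s e_gt0; [lra|lra|].
    by exists s'; split => //; lra.
  have [s' [xs' s'y fs]] := key s0 e s0a s0b (lexx _) e_gt0.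
  by exists s'; split => //; lra.
- have e2 : 0 < e0 / 2 by lra.
  have [s1 [xs1 s1y fs1]] := key s0 _ s0a s0b (lexx _) e2.
  move=> fx; have [||s2 [s2a s2x fs2]] := fx s1 _ _ _ e2; [lra|lra|].
  have := H s2 _ s2x; lra.
Qed.

(** An enumeration of the rationals in (0,1), repeating 1/2 where the code is
    not that of such a rational. *)
Definition unit_rat (i : nat) : R :=
  if unpickle i is Some q then
    if 0 < (ratr q : R) < 1 then ratr q else 2^-1
  else 2^-1.

Lemma unit_rat_gt0 i : 0 < unit_rat i.
Proof.
rewrite /unit_rat; case: unpickle => [q|]; last by rewrite invr_gt0.
by case: ifPn => [/andP[]//|_]; rewrite invr_gt0.
Qed.

Lemma unit_rat_lt1 i : unit_rat i < 1.
Proof.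
have h : 2^-1 < 1 :> R by lra.
rewrite /unit_rat; case: unpickle => [q|//].
by case: ifPn => [/andP[]//|_].
Qed.

Lemma unit_rat_dense (x y : R) : 0 <= x -> x < y -> y <= 1 ->
  exists i, x < unit_rat i < y.
Proof.
move=> x0 xy y1; have [q] := rat_in_itvoo xy; rewrite in_itv/= => /andP[xq qy].
exists (pickle q); rewrite /unit_rat pickleK.
by rewrite (le_lt_trans x0 xq) (lt_le_trans qy y1)/= xq.
Qed.

(** The counterpart of [sup_before] when v lists the values of a path at the
    points of relative position [unit_rat i]; countable quantifiers make it an
    event. *)
Definition prefix_sup (t : R) : set (nat -> R) :=
  [set v | forall j k, exists i, unit_rat i < t /\ v j < v i + k.+1%:R^-1].

Lemma prefix_sup_le (s t : R) v : s <= t -> prefix_sup s v -> prefix_sup t v.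
Proof.
move=> st vs j k; have [i [ds vji]] := vs j k.
by exists i; split => //; exact: lt_le_trans st.
Qed.

Lemma prefix_sup_eps (t : R) v :
  prefix_sup t v <->
  forall j e, 0 < e -> exists i, unit_rat i < t /\ v j < v i + e.
Proof.
split=> [vt j e e0|vt j k]; last by apply: vt; rewrite invr_gt0.
pose k := Num.truncn e^-1.
have [i [it vji]] := vt j k; exists i; split => //.
apply: (lt_le_trans vji); rewrite lerD2l -[e]invrK lef_pV2 ?posrE ?invr_gt0//.
by rewrite ltW// truncnS_gt.
Qed.

Lemma prefix_sup_affine (t a c : R) v : 0 < c ->
  prefix_sup t (fun i => c * v i + a) <-> prefix_sup t v.
Proof.
move=> c0; split=> /prefix_sup_eps vt; apply/prefix_sup_eps => j e e0.
- have [i [it]] := vt j (c * e) (mulr_gt0 c0 e0).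
  by rewrite addrAC ltrD2r -mulrDr ltr_pM2l// => vji; exists i.
- have [i [it vji]] := vt j (e / c) (divr_gt0 e0 c0).
  exists i; split => //; rewrite addrAC ltrD2r.
  have -> : e = c * (e / c) by field; rewrite gt_eqF.
  by rewrite -mulrDr ltr_pM2l.
Qed.

Lemma regular_path_approx f (a L s e del : R) : regular_path f ->
  0 < L -> a < s -> s < a + L -> 0 < e -> 0 < del ->
  exists i, `|a + L * unit_rat i - s| < del /\ `|f (a + L * unit_rat i) - f s| < e.
Proof.
move=> [_ freg] L0 sa sb e0 del0.
suff [x [y [ax xy yb H]]] : exists x y, [/\ a <= x, x < y, y <= a + L &
    forall z, x < z -> z < y -> `|z - s| < del /\ `|f z - f s| < e].
  have [|||i /andP[xi iy]] := @unit_rat_dense ((x - a) / L) ((y - a) / L).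
  - by rewrite divr_ge0 ?subr_ge0// ltW.
  - by rewrite ltr_pM2r ?invr_gt0// ltrD2r.
  - by rewrite ler_pdivrMr// mul1r lerBlDl.
  exists i; apply: H.
  - by move: xi; rewrite ltr_pdivrMr// mulrC ltrBlDl.
  - by move: iy; rewrite ltr_pdivlMr// mulrC ltrBrDl.
case: (freg s) => fs.
- have : \forall z \near s^'-, `|z - s| < del /\ `|f z - f s| < e.
    near=> z; split.
      rewrite distrC; near: z; apply: cvgr_dist_lt => //.
      by apply: cvg_within_filter; exact: cvg_id.
    by rewrite distrC; near: z; move/cvgrPdist_lt : fs; exact.
  case=> r /= r0 H; exists (Num.max a (s - r)), s; split => //.
  + by rewrite le_max lexx.
  + by rewrite gt_max sa/=; lra.
  + exact: ltW.
  + move=> z; rewrite gt_max => /andP[az zr] zs; apply: H => //=.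
    by rewrite ltr_norml; apply/andP; split; lra.
- have : \forall z \near s^'+, `|z - s| < del /\ `|f z - f s| < e.
    near=> z; split.
      rewrite distrC; near: z; apply: cvgr_dist_lt => //.
      by apply: cvg_within_filter; exact: cvg_id.
    by rewrite distrC; near: z; move/cvgrPdist_lt : fs; exact.
  case=> r /= r0 H; exists s, (Num.min (a + L) (s + r)); split => //.
  + exact: ltW.
  + by rewrite lt_min sb/=; lra.
  + by rewrite ge_min lexx.
  + move=> z sz; rewrite lt_min => /andP[zb zr]; apply: H => //=.
    by rewrite ltr_norml; apply/andP; split; lra.
Unshelve. all: by end_near. Qed.

(** A regular path has, near each time, times a + L * unit_rat i with values as
    close as desired, so the sampled and the full conditions agree. *)
Lemma prefix_sup_path f (a L t : R) : regular_path f -> 0 < L -> t <= 1 ->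
  prefix_sup t (fun i => f (a + L * unit_rat i)) <->
  sup_before f a (a + L * t) (a + L).
Proof.
move=> freg L0 t1.
have itv i : a < a + L * unit_rat i /\ a + L * unit_rat i < a + L.
  rewrite ltrDl mulr_gt0 ?unit_rat_gt0//; split => //.
  by rewrite ltrD2l -[ltRHS]mulr1 ltr_pM2l// unit_rat_lt1.
split=> [/prefix_sup_eps H s sa sb e e0|H].
- have e2 : 0 < e / 2 by rewrite divr_gt0.
  have [j [_]] := regular_path_approx freg L0 sa sb e2 e2.
  rewrite ltr_norml => /andP[f1 f2].
  have [i [it fji]] := H j _ e2.
  exists (a + L * unit_rat i); split; first by have [] := itv i.
  + by rewrite ltrD2l ltr_pM2l.
  + by move: f1 f2 fji; lra.
- apply/prefix_sup_eps => j e e0.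
  have e2 : 0 < e / 2 by rewrite divr_gt0.
  have [ja jb] := itv j.
  have [s [sa st fjs]] := H _ ja jb _ e2.
  have Lt : L * t <= L by rewrite -[leRHS]mulr1 ler_pM2l.
  have st0 : 0 < a + L * t - s by rewrite subr_gt0.
  have sb : s < a + L by lra.
  have [i []] := regular_path_approx freg L0 sa sb e2 st0.
  rewrite !ltr_norml => /andP[d1 d2] /andP[f1 f2].
  exists i; split.
  + by rewrite -(ltr_pM2l L0); move: d2; lra.
  + by move: f1 f2 fjs; lra.
Qed.

(** The value 1 is for the case where no proper part of the interval reaches the
    supremum; the position is then the right endpoint. *)
Definition prefix_position v : R :=
  inf [set x | x = 1 \/ exists2 i, x = unit_rat i & prefix_sup (unit_rat i) v].

Let position_lb v : lbound
  [set x | x = 1 \/ exists2 i, x = unit_rat i & prefix_sup (unit_rat i) v] 0.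
Proof. by move=> x [->//|[i -> _]]; rewrite ltW// unit_rat_gt0. Qed.

Lemma prefix_position_ge0 v : 0 <= prefix_position v.
Proof. by apply: lb_le_inf; [exists 1; left|exact: position_lb]. Qed.

Lemma prefix_position_le1 v : prefix_position v <= 1.
Proof. by apply: ge_inf; [exists 0; exact: position_lb|left]. Qed.

Lemma prefix_position_le i v : prefix_sup (unit_rat i) v ->
  prefix_position v <= unit_rat i.
Proof.
by move=> vi; apply: ge_inf; [exists 0; exact: position_lb|right; exists i].
Qed.

Lemma prefix_position_lt (x : R) v : x <= 1 ->
  prefix_position v < x <->
  exists i, unit_rat i < x /\ prefix_sup (unit_rat i) v.
Proof.
move=> x1; split=> [vx|[i [ix vi]]]; last first.
  exact: le_lt_trans (prefix_position_le vi) ix.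
have [|y [->|[i -> vi]] yx] := @inf_lt _ _ x _ vx; first by exists 1; left.
- by move: yx; rewrite ltNge x1.
- by exists i.
Qed.

Section PathPosition.
Variables (f : R -> R) (a L : R).
Hypotheses (freg : regular_path f) (L0 : 0 < L).
Let p := a + L * prefix_position (fun i => f (a + L * unit_rat i)).

Lemma position_ge : a <= p.
Proof. by rewrite lerDl mulr_ge0 ?prefix_position_ge0// ltW. Qed.

Lemma position_le : p <= a + L.
Proof. by rewrite lerD2l -[leRHS]mulr1 ler_pM2l// prefix_position_le1. Qed.

Lemma sup_before_after (q : R) : p < q -> q <= a + L ->
  sup_before f a q (a + L).
Proof.
move=> pq qL.
have : prefix_position (fun i => f (a + L * unit_rat i)) < (q - a) / L.
  by rewrite ltr_pdivlMr// mulrC ltrBrDl.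
move=> /prefix_position_lt[|i [iq]].
  by rewrite ler_pdivrMr// mul1r lerBlDl.
move=> /(prefix_sup_path _ freg L0 (ltW (unit_rat_lt1 i))).
apply: sup_before_le; rewrite -lerBrDl mulrC -ler_pdivlMr//.
exact: ltW.
Qed.

Lemma not_sup_before_prior (q : R) : a < q -> q < p ->
  ~ sup_before f a q (a + L).
Proof.
move=> aq qp fq.
have qa0 : 0 <= (q - a) / L by rewrite divr_ge0 ?subr_ge0// ltW.
have qpos : (q - a) / L < prefix_position (fun i => f (a + L * unit_rat i)).
  by rewrite ltr_pdivrMr// mulrC ltrBlDl.
have [i /andP[qi ip]] := unit_rat_dense qa0 qpos (prefix_position_le1 _).
suff : prefix_sup (unit_rat i) (fun i => f (a + L * unit_rat i)).
  by move=> /prefix_position_le; rewrite leNgt ip.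
apply/prefix_sup_path => //; first by rewrite ltW// unit_rat_lt1.
apply: sup_before_le fq; rewrite -lerBlDl mulrC -ler_pdivrMr//.
exact: ltW.
Qed.

End PathPosition.
(** * The leftmost position of the supremum *)

Lemma first_kind_locally_bounded f (t : R) : first_kind_discontinuities f ->
  exists C, \forall s \near t, f s <= C.
Proof.
move=> /(_ t)[/cvg_ex[l fl] /cvg_ex[r fr]].
have [e1 /= e10 H1] : \forall s \near t^'-, f s <= l + 1.
  by apply: (cvgr_le _ fl); rewrite ltrDl.
have [e2 /= e20 H2] : \forall s \near t^'+, f s <= r + 1.
  by apply: (cvgr_le _ fr); rewrite ltrDl.
exists (Num.max (f t) (Num.max (l + 1) (r + 1))).
exists (Num.min e1 e2); first by rewrite /= lt_min e10.
move=> s; rewrite /= lt_min => /andP[s1 s2]; rewrite !le_max.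
have [st|ts|->] := ltgtP s t; last by rewrite lexx.
- by rewrite H1 ?orbT.
- by rewrite H2 ?orbT.
Qed.

(** Locally bounded by the existence of one-sided limits, hence bounded on the
    compact interval. *)
Lemma first_kind_bounded f (a b : R) : first_kind_discontinuities f ->
  exists C, forall s, a <= s -> s <= b -> f s <= C.
Proof.
move=> ff.
have /compact_near_coveringP cab : compact `[a, b] by exact: segment_compact.
have : \forall C \near +oo, `[a, b] `<=` [set s | f s <= C].
  apply: cab => t _; have [C fC] := first_kind_locally_bounded t ff.
  exists ([set s | f s <= C], [set D | C <= D]).
    by split => //=; exists C; split; [exact: num_real|move=> D /ltW].
  by move=> [s D] /= [fs CD]; exact: le_trans CD.
case=> C [_ H]; exists (C + 1) => s sa sb.
by apply: (H (C + 1)); rewrite ?ltrDl//= in_itv/= sa sb.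
Qed.

Lemma left_limit_le f (t y c C : R) : f @ t^'- --> y -> c < t ->
  (forall s, c < s -> s < t -> f s <= C) -> y <= C.
Proof.
move=> fy ct H; apply: (cvgr_to_le fy); near=> s; apply: H.
  by near: s; exact: nbhs_left_gt.
by near: s; exact: nbhs_left_lt.
Unshelve. all: by end_near. Qed.

Lemma right_limit_le f (t y c C : R) : f @ t^'+ --> y -> t < c ->
  (forall s, t < s -> s < c -> f s <= C) -> y <= C.
Proof.
move=> fy ct H; apply: (cvgr_to_le fy); near=> s; apply: H.
  by near: s; exact: nbhs_right_gt.
by near: s; exact: nbhs_right_lt.
Unshelve. all: by end_near. Qed.

Lemma le_cases (x y : R) : x <= y -> x = y \/ x < y.
Proof. by rewrite le_eqVlt => /predU1P. Qed.

(** One argument serves for open and closed intervals: an endpoint may belong to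
    I provided that the path is continuous there from inside, for then it
    contributes neither to the supremum nor to the local values.  The point p is
    characterized by [after] and [prior], which say that the supremum is reached
    on (a, q) for q > p and not for q < p. *)
Section LeftmostSupPosition.
Variables (f : R -> R) (a b p : R) (I : set R).
Hypotheses (ff : first_kind_discontinuities f) (ab : a < b).
Hypotheses (abI : `]a, b[ `<=` I) (Iab : I `<=` `[a, b]).
Hypotheses (fa : I a -> f @ a^'+ --> f a) (fb : I b -> f @ b^'- --> f b).
Hypotheses (ap : a <= p) (pb : p <= b).
Hypothesis after : forall q, p < q -> q < b -> sup_before f a q b.
Hypothesis prior : forall q, a < q -> q < p -> ~ sup_before f a q b.

Let M := sup (f @` I).

Let I_itv s : a < s -> s < b -> I s.
Proof. by move=> sa sb; apply: abI; rewrite /= in_itv/= sa. Qed.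

Let I_le s : I s -> a <= s /\ s <= b.
Proof. by move=> /Iab; rewrite /= in_itv/= => /andP[]. Qed.

Let le_M s : I s -> f s <= M.
Proof.
move=> Is; apply: ub_le_sup; last by exists s.
have [C HC] := first_kind_bounded a b ff.
by exists C => _ [u /I_le[au ub] <-]; exact: HC.
Qed.

Let M_le C : (forall s, a < s -> s < b -> f s <= C) -> M <= C.
Proof.
move=> H; apply: ge_sup.
  have [am mb] := midf_lt ab.
  by exists (f ((a + b) / 2)), ((a + b) / 2) => //; exact: I_itv.
move=> _ [s Is <-]; have [sa sb] := I_le Is.
have [sE|{}sa] := le_cases sa.
  by move: Is; rewrite -sE => /fa fs; exact: (right_limit_le fs ab).
have [sE|{}sb] := le_cases sb; last exact: H.
by move: Is; rewrite sE => /fb fs; exact: (left_limit_le fs ab).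
Qed.

Let closure_le t : closure I t -> a <= t /\ t <= b.
Proof.
move=> /(closureS Iab).
have -> : closure `[a, b] = `[a, b]%classic :> set R.
  by apply/esym/closure_id; exact: interval_closed.
by rewrite /= in_itv/= => /andP[].
Qed.

Let le_closure t : a <= t -> t <= b -> closure I t.
Proof.
move: (ab) => ab' ta tb; apply: (closureS abI) => B [e /= e0 eB].
have [tm|tm] := leP t ((a + b) / 2).
- exists (Num.min (t + e / 2) ((t + b) / 2)); split.
    rewrite /= in_itv/=; apply/andP; split.
      by rewrite lt_min; apply/andP; split; lra.
    by rewrite gt_min; apply/orP; right; lra.
  apply: eB => /=; rewrite distrC ger0_norm.
    by rewrite ltrBlDl gt_min; apply/orP; left; lra.
  by rewrite subr_ge0 le_min; apply/andP; split; lra.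
- exists (Num.max (t - e / 2) ((t + a) / 2)); split.
    rewrite /= in_itv/=; apply/andP; split.
      by rewrite lt_max; apply/orP; right; lra.
    by rewrite gt_max; apply/andP; split; lra.
  apply: eB => /=; rewrite ger0_norm.
    by rewrite ltrBlDl addrC -ltrBlDl lt_max; apply/orP; left; lra.
  by rewrite subr_ge0 ge_max; apply/andP; split; lra.
Qed.

Let local_values_le t : a <= t -> t <= b -> ubound (local_values I f t) M.
Proof.
move=> ta tb y [[It ->]|[[s Is st] fy]|[[s Is ts] fy]].
- exact: le_M.
- apply: (left_limit_le fy st) => u su ut; apply: le_M; apply: I_itv.
    by have [] := I_le Is; lra.
  by lra.
- apply: (right_limit_le fy ts) => u su ut; apply: le_M; apply: I_itv.
    by lra.
  by have [] := I_le Is; lra.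
Qed.

(** If every local value at p were below M, then f would stay below some D < M
    on a neighbourhood of p, and, by [prior], also on the part of the interval
    left of it; but by [after] the values on this region approach M. *)
Let attained : local_values I f p M.
Proof.
move: (ab) (ap) (pb) => ab_lt ap_le pb_le.
apply: contrapT => nM.
have left_gap : exists q C, [/\ a <= q, q <= p, C < M,
    forall s, a < s -> s < q -> f s <= C &
    forall s, q <= s -> s < p -> a < s -> f s <= C].
  have [pE|ap'] := le_cases ap.
    by exists a, (M - 1); split; [lra|lra|lra|move=> s; lra|move=> s; lra].
  have /cvg_ex[l fl] := (ff p).1.
  have Iq : exists2 s, I s & s < p.
    have [am mp] := midf_lt ap'.
    by exists ((a + p) / 2) => //; apply: I_itv => //; exact: lt_le_trans pb.
  have lM : l < M.
    rewrite lt_neqAle; apply/andP; split.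
      by apply/eqP => lE; apply: nM; rewrite -lE; apply: Or32.
    by apply: (local_values_le ap pb); apply: Or32.
  have [e /= e0 He] : \forall s \near p^'-, f s <= (l + M) / 2.
    by apply: (cvgr_le _ fl); lra.
  pose q := Num.max ((a + p) / 2) (p - e / 2).
  have q1 : (a + p) / 2 <= q by rewrite le_max lexx.
  have q2 : p - e / 2 <= q by rewrite le_max lexx orbT.
  have q3 : q < p by rewrite gt_max; apply/andP; split; lra.
  have aq : a < q by lra.
  have [s0 [e0' [s0a s0b e0'0 H]]] := not_sup_before (prior aq q3).
  have s0M : f s0 <= M by apply: le_M; exact: I_itv.
  have C1 : M - e0' <= Num.max (M - e0') ((l + M) / 2) by rewrite le_max lexx.
  have C2 : (l + M) / 2 <= Num.max (M - e0') ((l + M) / 2).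
    by rewrite le_max lexx orbT.
  exists q, (Num.max (M - e0') ((l + M) / 2)); split; [lra|lra| | |].
  - by rewrite gt_max; apply/andP; split; lra.
  - by move=> s sa sq; apply: le_trans C1; have := H s sa sq; lra.
  - move=> s qs sp _; apply: le_trans C2; apply: He => //=.
    by rewrite ger0_norm; lra.
have right_gap : exists q C, [/\ C < M,
    forall s, p < s -> s < q -> s < b -> f s <= C &
    (p < b -> p < q) /\ q <= b].
  have [pE|pb'] := le_cases pb.
    by exists b, (M - 1); split; [lra|move=> s; lra|split; lra].
  have /cvg_ex[r fr] := (ff p).2.
  have Iq : exists2 s, I s & p < s.
    have [pm mb] := midf_lt pb'.
    by exists ((p + b) / 2) => //; apply: I_itv => //; exact: le_lt_trans pm.
  have rM : r < M.
    rewrite lt_neqAle; apply/andP; split.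
      by apply/eqP => lE; apply: nM; rewrite -lE; apply: Or33.
    by apply: (local_values_le ap pb); apply: Or33.
  have [e /= e0 He] : \forall s \near p^'+, f s <= (r + M) / 2.
    by apply: (cvgr_le _ fr); lra.
  exists (Num.min b (p + e)), ((r + M) / 2); split; first by lra.
    move=> s ps; rewrite lt_min => /andP[sb spe] _; apply: He => //=.
    by rewrite ltr0_norm; lra.
  by rewrite lt_min ge_min lexx; split => // ->/=; lra.
have [q [C [aq qp CM H1 H2]]] := left_gap.
have [q' [C' [C'M H3 [pq' q'b]]]] := right_gap.
have [D [DM CD C'D fpD]] : exists D, [/\ D < M, C <= D, C' <= D &
    I p -> f p <= D].
  have [Ip|nIp] := pselect (I p).
    have fpM : f p < M.
      rewrite lt_neqAle le_M// andbT; apply/eqP => fpM.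
      by apply: nM; apply: Or31.
    exists (Num.max (f p) (Num.max C C')).
    by rewrite !gt_max fpM CM C'M !le_max !lexx !orbT; split.
  by exists (Num.max C C'); rewrite !gt_max CM C'M !le_max !lexx !orbT; split.
have fD s : a < s -> s < b -> s < q' \/ s <= p -> f s <= D.
  move=> sa sb sq'.
  have [sp|ps|sE] := ltgtP s p.
  - have [sq|qs] := ltP s q; first exact: le_trans (H1 _ sa sq) CD.
    exact: le_trans (H2 _ qs sp sa) CD.
  - by case: sq' => [sq'|]; [exact: le_trans (H3 _ ps sq' sb) C'D|lra].
  - by rewrite sE; apply: fpD; rewrite -sE; exact: I_itv.
suff : M <= (M + D) / 2 by lra.
have [pE|pb'] := le_cases pb.
  apply: M_le => s sa sb; have := fD s sa sb.
  by rewrite pE => /(_ (or_intror (ltW sb))); lra.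
apply: M_le => s sa sb.
have pq := pq' pb'.
have pq2 : p < (p + q') / 2 by lra.
have q2b : (p + q') / 2 < b by lra.
have e0 : 0 < (M - D) / 2 by lra.
have [s' [s'a s'q fs]] := after pq2 q2b sa sb e0.
have s'b : s' < b by lra.
have s'q' : s' < q' by lra.
by have := fD s' s'a s'b (or_introl s'q'); lra.
Qed.

(** No t < p has local supremum M: between t and p there is a q such that f stays
    away from M on (a, q), by [prior]. *)
Lemma leftmost_sup_positionE : leftmost_sup_position I f = p.
Proof.
rewrite /leftmost_sup_position.
set Z := (X in inf X).
have Zp : Z p.
  by split; [exact: le_closure|split; [exact: attained|exact: local_values_le]].
have Zlb : lbound Z p.
  move: (ab) (ap) (pb) => ab_lt ap_le pb_le t [/closure_le[ta tb] [tM _]].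
  rewrite leNgt; apply/negP => tp.
  pose q := (t + p) / 2.
  have aq : a < q by rewrite /q; lra.
  have tq : t < q by rewrite /q; lra.
  have qp : q < p by rewrite /q; lra.
  have [s0 [e [s0a s0b e0 H]]] := not_sup_before (prior aq qp).
  have s0M : f s0 <= M by apply: le_M; exact: I_itv.
  suff : M <= M - e by lra.
  have fM s : a < s -> s < q -> f s <= M - e.
    by move=> sa sq; have := H s sa sq; lra.
  move: tM; rewrite -/M => -[[It Mft]|[[s Is st] fy]|[_ fy]].
  - rewrite [leLHS]Mft; have [tE|ta'] := le_cases ta; last by apply: fM.
    move: It; rewrite -tE => /fa fy; apply: (right_limit_le fy aq).
    by move=> s sa sq; exact: fM.
  - have at' : a < t by have [] := I_le Is; lra.
    by apply: (left_limit_le fy at') => u ua ut; apply: fM => //; lra.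
  - by apply: (right_limit_le fy tq) => u ut uq; apply: fM => //; lra.
apply/eqP; rewrite eq_le ge_inf//=; last by exists p.
by rewrite lb_le_inf//; exists p.
Qed.

End LeftmostSupPosition.

End Paths.

(** * Laws of countably many values of a process *)

Section SequenceSpace.
Variable R : realType.

(** Rectangles rather than arbitrary cylinder sets: two of them intersect
    coordinate by coordinate, whatever their numbers of constrained
    coordinates. *)
Definition cylinders : set (set (nat -> R)) :=
  [set B | exists A : nat -> set R, [/\ forall i, measurable (A i),
    exists n, forall i, (n <= i)%N -> A i = setT &
    B = [set v | forall i, A i (v i)]]].

Definition sequence_space := g_sigma_algebraType cylinders.

Lemma setI_closed_cylinders : setI_closed cylinders.
Proof.
move=> _ _ [A [mA [n An] ->]] [B [mB [m Bm] ->]].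
exists (fun i => A i `&` B i); split.
- by move=> i; exact: measurableI.
- exists (maxn n m) => i; rewrite geq_max => /andP[ni mi].
  by rewrite An// Bm// setIT.
- by apply/seteqP; split=> [v [Av Bv] i|v ABv]; [split|split=> i; case: (ABv i)].
Qed.

Lemma measurable_coordinate (i : nat) :
  measurable_fun setT (fun v : sequence_space => v i).
Proof.
move=> _ B mB; rewrite setTI; apply: sub_sigma_algebra.
exists (fun j => if j == i then B else setT); split.
- by move=> j; case: ifP.
- by exists i.+1 => j ij; rewrite gtn_eqF.
- by apply/seteqP; split=> [v Bv j|v /(_ i)]; [case: eqP => // ->|rewrite eqxx].
Qed.

End SequenceSpace.

Section SequenceLaw.
Context {d : measure_display} {Omega : measurableType d} {R : realType}.
Variable P : probability Omega R.
Implicit Types X Y : R -> Omega -> R.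

Lemma measurable_sequence (X : nat -> Omega -> R) :
  (forall i, measurable_fun setT (X i)) ->
  measurable_fun setT (fun w => (fun i => X i w) : (sequence_space R)).
Proof.
move=> mX.
refine (@measurability _ _ Omega (sequence_space R) setT _ (@cylinders R) erefl _).
move=> _ [_ [A [mA _ ->]] <-]; rewrite setTI.
rewrite [X in measurable X](_ : _ = \bigcap_i (X i @^-1` A i)).
  by apply: bigcapT_measurable => i; rewrite -[X in measurable X]setTI; exact: mX.
by apply/seteqP; split=> [w Aw i _|w Aw i]; exact: Aw.
Qed.

(** The two laws on the space of sequences agree on the rectangles, a generating
    family stable under intersection, hence everywhere. *)
Lemma same_fdd_sequence X Y (tau : nat -> R) (B : set (sequence_space R)) :
  (forall t, measurable_fun setT (X t)) -> (forall t, measurable_fun setT (Y t)) ->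
  same_fdd P X Y -> measurable B ->
  P [set w | B (fun i => X (tau i) w)] = P [set w | B (fun i => Y (tau i) w)].
Proof.
move=> mX mY XY mB.
pose seqof (Z : R -> Omega -> R) (w : Omega) : (sequence_space R) := fun i => Z (tau i) w.
have mfX : measurable_fun setT (seqof X) by apply: measurable_sequence => i.
have mfY : measurable_fun setT (seqof Y) by apply: measurable_sequence => i.
pose fX : {mfun Omega >-> (sequence_space R)} :=
  HB.pack (seqof X) (isMeasurableFun.Build _ _ _ _ (seqof X) mfX).
pose fY : {mfun Omega >-> (sequence_space R)} :=
  HB.pack (seqof Y) (isMeasurableFun.Build _ _ _ _ (seqof Y) mfY).
change (distribution P fX B = distribution P fY B).
apply: (@measure_unique _ R (sequence_space R) (@cylinders R) (fun=> setT)) => //.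
- exact: setI_closed_cylinders.
- move=> _; exists (fun=> setT); split => //; first by exists 0%N.
  by apply/seteqP; split.
- by rewrite bigcup_const.
- move=> _ [A [mA [n An] ->]].
  pose t : n.-tuple R := [tuple tau i | i < n].
  pose D : set (n.-tuple R) := [set u | forall i : 'I_n, A i (tnth u i)].
  have cylE (Z : R -> Omega -> R) : [set w : Omega | forall i, A i (Z (tau i) w)] =
      [set w | D [tuple Z (tnth t i) w | i < n]].
    apply/seteqP; split=> w Aw i; first by rewrite !tnth_mktuple; exact: Aw.
    have [ni|ni] := leqP n i; first by rewrite An.
    by have := Aw (Ordinal ni); rewrite !tnth_mktuple.
  have mD : measurable D.
    rewrite (_ : D =
      \bigcap_(i in [set: 'I_n]) ((fun u : n.-tuple R => tnth u i) @^-1` A i)).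
      apply: fin_bigcap_measurable => //= i _.
      by rewrite -[X in measurable X]setTI; apply: measurable_tnth.
    by apply/seteqP; split=> [u Du i _|u Du i]; [exact: Du|exact: (Du i)].
  have := XY n t D mD; rewrite -!cylE; exact.
- by move=> _; apply: le_lt_trans (probability_le1 _ _) _; rewrite ?ltry.
Qed.

End SequenceLaw.

(** * The position of the supremum as a random variable *)

Section SupPositionLaw.
Context {d : measure_display} {Omega : measurableType d} {R : realType}.
Variable P : probability Omega R.

Lemma measurable_prefix_sup (t : R) :
  measurable (prefix_sup t : set (sequence_space R)).
Proof.
rewrite (_ : prefix_sup t = \bigcap_j \bigcap_k \bigcup_i
  [set v : sequence_space R | unit_rat R i < t /\ v j < v i + k.+1%:R^-1]); last first.
  apply/seteqP; split=> [v H j _ k _|v H j k].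
    by have [i ?] := H j k; exists i.
  by have [i _ ?] := H j I k I; exists i.
apply: bigcapT_measurable => j; apply: bigcapT_measurable => k.
apply: bigcupT_measurable => i.
have [it|ti] := ltP (unit_rat R i) t; last first.
  by rewrite (_ : [set _ | _] = set0)//; apply/seteqP; split => // v [].
rewrite (_ : [set _ | _] =
    (fun v : sequence_space R => v j < v i + k.+1%:R^-1) @^-1` [set true]); last first.
  by apply/seteqP; split => [v []|v].
rewrite -[X in measurable X]setTI; apply: measurable_fun_ltr => //.
  exact: measurable_coordinate.
by apply: measurable_funD => //; exact: measurable_coordinate.
Qed.

Lemma measurable_prefix_position :
  measurable_fun setT (@prefix_position R : sequence_space R -> R).
Proof.
move=> mT; refine (@measurability _ _ (sequence_space R) R setT _ _
  (RGenInftyO.measurableE R) _ mT).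
move=> _ [_ [x ->] <-]; rewrite setTI.
have [x1|x1] := leP x 1; last first.
  rewrite (_ : _ @^-1` _ = setT)//; apply/seteqP; split => // v _ /=.
  by rewrite in_itv/=; exact: le_lt_trans (prefix_position_le1 _) x1.
rewrite (_ : _ @^-1` _ = \bigcup_i
  (if unit_rat R i < x then prefix_sup (unit_rat R i) else set0)).
  apply: bigcupT_measurable => i; case: ifP => // _.
  exact: measurable_prefix_sup.
apply/seteqP; split => v /=.
  rewrite in_itv/= => /(prefix_position_lt _ x1)[i [ix vi]].
  by exists i => //; rewrite ix.
move=> [i _]; case: ifP => // ix vi; rewrite in_itv/=.
by apply/(prefix_position_lt _ x1); exists i.
Qed.

Variable X : R -> {RV P >-> R}.

Definition samples (a L : R) (w : Omega) : sequence_space R :=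
  fun i => X (a + L * unit_rat R i) w.

Lemma measurable_samples (a L : R) : measurable_fun setT (samples a L).
Proof. by apply: measurable_sequence => i; exact: measurable_funPT. Qed.

Lemma measurable_prefix_event (a L t : R) :
  measurable [set w | prefix_sup t (samples a L w)].
Proof.
rewrite -[X in measurable X]setTI.
by apply: (measurable_samples a L) => //; exact: measurable_prefix_sup.
Qed.

Definition sup_position (a L : R) (w : Omega) : R :=
  a + L * prefix_position (samples a L w).

Lemma measurable_sampled_position (a L : R) :
  measurable_fun setT (fun w => prefix_position (samples a L w)).
Proof.
apply: (@measurableT_comp _ _ _ _ _ _ (@prefix_position R : sequence_space R -> R)).
  exact: measurable_prefix_position.
exact: measurable_samples.
Qed.

Lemma measurable_sup_position (a L : R) : measurable_fun setT (sup_position a L).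
Proof.
apply: measurable_funD => //; apply: measurable_funM => //.
exact: measurable_sampled_position.
Qed.

HB.instance Definition _ (a L : R) :=
  isMeasurableFun.Build _ _ _ _ (sup_position a L) (measurable_sup_position a L).

Definition sup_position_rv (a L : R) : {RV P >-> R} := sup_position a L.

Variable h : R.
Hypothesis X_ss : self_similar P h X.
Hypothesis X_si : stationary_increments P X.

(** Stationary increments move a to 0 and self-similarity turns L into 1; the
    random shift by -X a w and the factor L ^ h leave the event unchanged by
    [prefix_sup_affine]. *)
Lemma prefix_sup_law (a L t : R) : 0 < L ->
  P [set w | prefix_sup t (samples a L w)] =
  P [set w | prefix_sup t (samples 0 1 w)].
Proof.
move=> L0.
have mX s : measurable_fun setT (X s) by exact: measurable_funPT.
have mS : measurable (prefix_sup t : set (sequence_space R)).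
  exact: measurable_prefix_sup.
have shift (Z : Omega -> R) (s : nat -> R) :
    P [set w | prefix_sup t (fun i => X (s i) w - Z w)] =
    P [set w | prefix_sup t (fun i => X (s i) w)].
  congr (P _); apply: eq_set => w; apply/propext.
  rewrite -(prefix_sup_affine t (- Z w) (fun i => X (s i) w) ltr01).
  suff -> : (fun i => 1 * X (s i) w - Z w) = (fun i => X (s i) w - Z w) by [].
  by apply/funext => i; rewrite mul1r.
transitivity (P [set w | prefix_sup t (fun i => X (L * unit_rat R i + a) w - X a w)]).
  rewrite shift; congr (P _); apply: eq_set => w; congr prefix_sup.
  by apply/funext => i; rewrite /samples addrC.
rewrite (same_fdd_sequence (fun i => L * unit_rat R i) _ _ (X_si a) mS); last 2 first.
  by move=> s; exact: measurable_funB.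
  by move=> s; exact: measurable_funB.
rewrite shift (same_fdd_sequence (unit_rat R) _ _ (X_ss L0) mS); last 2 first.
  by move=> s; exact: mX.
  by move=> s; exact: measurable_funM.
congr (P _); apply: eq_set => w; apply/propext.
rewrite -(prefix_sup_affine t 0 (samples 0 1 w) (powR_gt0 h L0)).
suff -> : (fun i => L `^ h * samples 0 1 w i + 0) =
          (fun i => L `^ h * X (unit_rat R i) w) by [].
by apply/funext => i; rewrite /samples add0r mul1r addr0.
Qed.

End SupPositionLaw.

(** * Regularity of almost all paths *)

Section RegularPaths.
Context {d : measure_display} {Omega : measurableType d} {R : realType}.
Variable P : probability Omega R.
Variable X : R -> {RV P >-> R}.
Variable h : R.
Hypothesis h0 : 0 < h.
Hypothesis X_ss : self_similar P h X.
Hypothesis X_si : stationary_increments P X.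

Lemma measurable_increment (s t : R) :
  measurable_fun setT (fun w => `|X s w - X t w|).
Proof.
by apply: measurableT_comp => //; apply: measurable_funB; exact: measurable_funPT.
Qed.

(** Stationarity compares the increment at c with the one at 0, and
    self-similarity is applied to the pair of times e and 0. *)
Lemma increment_law (l e c del : R) : 0 < l ->
  P [set w | del < `|X (l * e + c) w - X c w|] =
  P [set w | del < l `^ h * `|X e w - X 0 w|].
Proof.
move=> l0.
have mX s : measurable_fun setT (X s) by exact: measurable_funPT.
have mlt (f : sequence_space R -> R) : measurable_fun setT f ->
    measurable [set v | del < `|f v|].
  move=> mf; rewrite (_ : [set _ | _] = (fun v => del < `|f v|) @^-1` [set true]).
    rewrite -[X in measurable X]setTI; apply: measurable_fun_ltr => //.
    exact: measurableT_comp.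
  by apply/seteqP; split.
have mc i := @measurable_coordinate R i.
rewrite (same_fdd_sequence (fun=> l * e) _ _ (X_si c) (mlt _ (mc 0%N))); last 2 first.
  by move=> s; exact: measurable_funB.
  by move=> s; exact: measurable_funB.
transitivity (P [set w | del < `|X (l * e) w - X (l * 0) w|]).
  by rewrite mulr0.
have mB := mlt _ (measurable_funB (mc 0%N) (mc 1%N)).
rewrite (same_fdd_sequence (fun i => if i is 0%N then e else 0) _ _ (X_ss l0) mB);
  last 2 first.
  by move=> s; exact: mX.
  by move=> s; exact: measurable_funM.
congr (P _); apply: eq_set => w /=.
by rewrite -mulrBr normrM gtr0_norm// powR_gt0.
Qed.

Lemma increment_small (e c del eps : R) : 0 < del -> 0 < eps ->
  \forall n \near \oo,
    (P [set w | (del < `|X (harmonic n * e + c) w - X c w|)%R] < eps%:E)%E.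
Proof.
move=> del0 eps0.
pose Z : {RV P >-> R} := HB.pack (fun w => `|X e w - X 0 w|)
  (isMeasurableFun.Build _ _ _ _ (fun w => `|X e w - X 0 w|)
     (measurable_increment e 0)).
have [r [r0 Zr]] : exists r : R, 0 < r /\ (ccdf Z r < eps%:E)%E.
  have /fine_cvgP[Zfin Z0] := cvg_ccdfy0 Z.
  have Zeps : \forall r \near +oo%R, fine (ccdf Z r) < eps.
    exact: (cvgr_lt _ Z0).
  near (pinfty_nbhs R) => r; exists r; split; first by near: r; exact: nbhs_pinfty_gt.
  rewrite -[ltLHS]fineK; last by near: r.
  by rewrite lte_fin; near: r.
have lr : \forall l \near 0^'+, l `^ h <= del / r.
  by apply: (cvgr_le _ (powR_cvg0 h0)); rewrite divr_gt0.
have hr : \forall n \near \oo, harmonic n `^ h <= del / r.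
  case: lr => u /= u0 Hu; near=> n; apply: Hu; last exact: harmonic_gt0.
  by near: n; move/cvgrPdist_lt : (@cvg_harmonic R); exact.
apply: filterS hr => n hr.
rewrite increment_law; last exact: harmonic_gt0.
apply: le_lt_trans Zr; apply: le_measure; rewrite ?inE.
- rewrite (_ : [set _ | _] =
      (fun w => del < harmonic n `^ h * `|X e w - X 0 w|) @^-1` [set true]).
    rewrite -[X in measurable X]setTI; apply: measurable_fun_ltr => //.
    by apply: measurable_funM => //; exact: measurable_increment.
  by apply/seteqP; split.
- by rewrite -[X in measurable X]setTI; exact: measurable_funPT.
- move=> w /= dw; rewrite in_itv/= andbT ltNge; apply/negP => Zw.
  move: dw; rewrite ltNge => /negP; apply.
  apply: (@le_trans _ _ (del / r * r)); last by rewrite divfK// gt_eqF.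
  by apply: ler_pM => //; exact: powR_ge0.
Unshelve. all: by end_near. Qed.

(** If the sequence stayed away from X c by 1 / k.+1 from the index m on, this
    event would be included in events of arbitrarily small probability, by
    [increment_small]. *)
Lemma ae_sequential_continuity (e c : R) :
  {ae P, forall w, forall l,
    X (harmonic n * e + c) w @[n --> \oo] --> l -> l = X c w}.
Proof.
have null (k m : nat) : {ae P, forall w, exists n, (m <= n)%N /\
    `|X (harmonic n * e + c) w - X c w| <= k.+1%:R^-1}.
  pose A n := [set w | k.+1%:R^-1 < `|X (harmonic n * e + c) w - X c w|].
  have mA n : measurable (A n).
    rewrite (_ : A n =
        (fun w => k.+1%:R^-1 < `|X (harmonic n * e + c) w - X c w|) @^-1` [set true]).
      rewrite -[X in measurable X]setTI; apply: measurable_fun_ltr => //.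
      exact: measurable_increment.
    by apply/seteqP; split.
  exists (\bigcap_(n in [set n | (m <= n)%N]) A n); split.
  - by apply: bigcap_measurable => //; exists m => /=.
  - apply/eqP; rewrite -measure_le0; apply/lee_addgt0Pr => eps eps0.
    have k0 : 0 < k.+1%:R^-1 :> R by rewrite invr_gt0.
    near \oo => n.
    rewrite add0e; apply: (@le_trans _ _ (P (A n))).
      apply: le_measure; rewrite ?inE//.
        by apply: bigcap_measurable => //; exists m => /=.
      by apply: bigcap_inf => /=; near: n; exact: nbhs_infty_ge.
    by apply: ltW; near: n; exact: increment_small.
  - move=> w /= /forallNP H n /= mn; rewrite /A /= ltNge; apply/negP => ?.
    by apply: (H n).
have : {ae P, forall w, forall k m, exists n, (m <= n)%N /\
    `|X (harmonic n * e + c) w - X c w| <= k.+1%:R^-1}.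
  by apply: ae_foralln => k; apply: ae_foralln => m; exact: null.
apply: filterS => w H l Xl; apply/eqP; rewrite -subr_eq0 -normr_le0.
apply/ler_addgt0Pr => eps eps0; rewrite add0r.
pose k := Num.truncn (eps / 2)^-1.
have e20 : 0 < eps / 2 by rewrite divr_gt0.
have ke : k.+1%:R^-1 <= eps / 2.
  by rewrite -[leRHS]invrK lef_pV2 ?posrE ?invr_gt0// ltW// truncnS_gt.
move/cvgrPdist_le : Xl => /(_ _ e20)[m _ Hm].
have [n [mn Hn]] := H k m.
have -> : l - X c w = (l - X (harmonic n * e + c) w) +
  (X (harmonic n * e + c) w - X c w) by rewrite addrA subrK.
rewrite (le_trans (ler_normD _ _))// [leRHS]splitr lerD//.
  exact: Hm.
exact: le_trans ke.
Unshelve. all: by end_near. Qed.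

Lemma right_limit_sequence (f : R -> R) (c l : R) :
  f @ c^'+ --> l -> f (harmonic n * 1 + c) @[n --> \oo] --> l.
Proof.
move=> fl; apply: (cvg_comp (fun n => harmonic n * 1 + c) f _ fl).
move=> U [e /= e0 He]; near=> n; apply: He => /=.
  rewrite mulr1 opprD addrCA subrr addr0 normrN gtr0_norm; last exact: harmonic_gt0.
  by near: n; apply: (cvgr_lt _ (@cvg_harmonic R)).
by rewrite mulr1 ltrDr; exact: harmonic_gt0.
Unshelve. all: by end_near. Qed.

Lemma left_limit_sequence (f : R -> R) (c l : R) :
  f @ c^'- --> l -> f (harmonic n * -1 + c) @[n --> \oo] --> l.
Proof.
move=> fl; apply: (cvg_comp (fun n => harmonic n * -1 + c) f _ fl).
move=> U [e /= e0 He]; near=> n; apply: He => /=.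
  rewrite mulrN1 opprD opprK addrCA subrr addr0 gtr0_norm; last exact: harmonic_gt0.
  by near: n; apply: (cvgr_lt _ (@cvg_harmonic R)).
by rewrite mulrN1 gtrDr oppr_lt0; exact: harmonic_gt0.
Unshelve. all: by end_near. Qed.

Hypothesis X_paths : {ae P, forall w, first_kind_discontinuities (X ^~ w)}.

Lemma ae_right_continuous (c : R) :
  {ae P, forall w, X t w @[t --> c^'+] --> X c w}.
Proof.
apply: filterS2 X_paths (ae_sequential_continuity 1 c) => w Xw H.
have /cvg_ex[l Xl] := (Xw c).2.
by rewrite -(H _ (right_limit_sequence Xl)).
Qed.

Lemma ae_left_continuous (c : R) :
  {ae P, forall w, X t w @[t --> c^'-] --> X c w}.
Proof.
apply: filterS2 X_paths (ae_sequential_continuity (-1) c) => w Xw H.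
have /cvg_ex[l Xl] := (Xw c).1.
by rewrite -(H _ (left_limit_sequence Xl)).
Qed.

Lemma ae_countable (S : set R) (Q : R -> Omega -> Prop) : countable S ->
  (forall s, {ae P, forall w, Q s w}) -> {ae P, forall w, forall s, S s -> Q s w}.
Proof.
move=> /countable_injP[f finj] HQ.
have : {ae P, forall w, forall n, forall s, S s -> f s = n -> Q s w}.
  apply: ae_foralln => n.
  have [[s [Ss sn]]|nS] := pselect (exists s, S s /\ f s = n).
    apply: filterS (HQ s) => w Qs s' Ss' s'n.
    by rewrite (finj s' s) ?inE// s'n.
  by apply: nearW => w s Ss sn; case: nS; exists s.
by apply: filterS => w H s Ss; exact: (H (f s)).
Qed.

(** If f t differed from both one-sided limits, the values at times close to t
    but different from t would stay away from f t; so the approximating times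
    would eventually equal t, and t would belong to S. *)
Lemma separated_regular_path (f : R -> R) (S : set R) :
  first_kind_discontinuities f -> (forall s, S s -> f @ s^'+ --> f s) ->
  (forall t, exists s : nat -> R,
    [/\ forall n, S (s n), s @ \oo --> t & f (s n) @[n --> \oo] --> f t]) ->
  regular_path f.
Proof.
move=> ff fS sep; split => // t.
have /cvg_ex[l fl] := (ff t).1; have /cvg_ex[r fr] := (ff t).2.
have [lE|lN] := eqVneq l (f t); first by left; rewrite -lE.
have [rE|rN] := eqVneq r (f t); first by right; rewrite -rE.
exfalso.
have l0 : 0 < `|l - f t| / 2 by rewrite divr_gt0// normr_gt0 subr_eq0.
have r0 : 0 < `|r - f t| / 2 by rewrite divr_gt0// normr_gt0 subr_eq0.
have [s [Ss st fst]] := sep t.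
move/cvgrPdist_lt : (fl) => /(_ _ l0)[u /= u0 Hu].
move/cvgrPdist_lt : (fr) => /(_ _ r0)[v /= v0 Hv].
move/cvgrPdist_lt : (fst) => fst'.
near \oo => n.
have su : `|t - s n| < u by near: n; move/cvgrPdist_lt : st; exact.
have sv : `|t - s n| < v by near: n; move/cvgrPdist_lt : st; exact.
have fl' : `|f t - f (s n)| < `|l - f t| / 2 by near: n; exact: fst'.
have fr' : `|f t - f (s n)| < `|r - f t| / 2 by near: n; exact: fst'.
have [sn|sn|sE] := ltgtP (s n) t.
- have Hn := Hu _ su sn.
  have := ler_distD (f (s n)) l (f t).
  by rewrite (distrC (f (s n))); move: Hn fl'; lra.
- have Hn := Hv _ sv sn.
  have := ler_distD (f (s n)) r (f t).
  by rewrite (distrC (f (s n))); move: Hn fr'; lra.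
- have St : S t by rewrite -sE.
  by move/eqP: rN; apply; exact: (cvg_unique _ fr (fS t St)).
Unshelve. all: by end_near. Qed.

(** Continuity from the right at one time is almost sure, hence holds almost
    surely at all times of the countable separating set. *)
Lemma ae_regular_path : separable_process P X ->
  {ae P, forall w, regular_path (X ^~ w)}.
Proof.
move=> [S cS sep].
have XS : {ae P, forall w, forall s, S s -> X t w @[t --> s^'+] --> X s w}.
  by apply: ae_countable => // s; exact: ae_right_continuous.
apply: filterS3 X_paths sep XS => w Xw sepw XSw.
exact: (@separated_regular_path _ S).
Qed.

End RegularPaths.

(** * Identification of a density *)

Section Densities.
Variable R : realType.

Section DensityMeasure.
Variable g : R -> \bar R.
Hypotheses (mg : measurable_fun setT g) (g0 : forall x, (0 <= g x)%E).

(** Integration of a density, as a measure, so that uniqueness of measures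
    applies to it. *)
Definition density_measure (A : set R) : \bar R :=
  (\int[lebesgue_measure]_(x in A) g x)%E.

Let density_measure0 : density_measure set0 = 0%E.
Proof. exact: integral_set0. Qed.

Let density_measure_ge0 A : (0 <= density_measure A)%E.
Proof. by apply: integral_ge0 => x _. Qed.

Let density_measure_sigma_additive : semi_sigma_additive density_measure.
Proof.
move=> F mF tF mUF; rewrite /density_measure ge0_integral_bigcup//; last first.
  exact: measurable_funTS.
by apply: is_cvg_ereal_nneg_natsum => n _; exact: integral_ge0.
Qed.

HB.instance Definition _ := isMeasure.Build _ _ _ density_measure
  density_measure0 density_measure_ge0 density_measure_sigma_additive.

Definition density_measure_canonical : {measure set R -> \bar R} := density_measure.

End DensityMeasure.

(** The density is only controlled inside (0,1), so uniqueness of measures is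
    applied on the intervals K n, which exhaust (0,1), and A is the increasing
    union of its intersections with them. *)
Lemma density_of_cdf (mu : {measure set R -> \bar R}) (psi : R -> R) :
  (mu setT < +oo)%E -> {in `]0, 1[, continuous psi} ->
  {in `]0, 1[, forall t, 0 <= psi t} ->
  (forall x y, 0 < x -> x < y -> y < 1 ->
    mu `]x, y]%classic = (\int[lebesgue_measure]_(t in `]x, y]) (psi t)%:E)%E) ->
  forall A : set R, measurable A -> A `<=` `]0, 1[ ->
    mu A = (\int[lebesgue_measure]_(t in A) (psi t)%:E)%E.
Proof.
move=> mufin cpsi psi0 H A mA A01.
pose g : R -> \bar R := (EFin \o psi) \_ `]0, 1[.
have mg : measurable_fun setT g.
  apply/(measurable_restrictT (EFin \o psi)) => //.
  apply/measurable_EFinP; apply: open_continuous_measurable_fun => //.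
  by move=> x; rewrite inE; exact: cpsi.
have g0 x : (0 <= g x)%E.
  rewrite /g patchE; case: ifPn => // /set_mem /psi0.
  by rewrite /= lee_fin.
have gE B : B `<=` `]0, 1[ ->
    density_measure g B = (\int[lebesgue_measure]_(t in B) (psi t)%:E)%E.
  move=> B01; apply: eq_integral => t; rewrite inE => Bt.
  by rewrite /g patchE mem_set//; exact: B01.
rewrite -gE//.
pose K (n : nat) : set R := `]n.+2%:R^-1, 1 - n.+2%:R^-1]%classic.
have mK n : measurable (K n) by exact: measurable_itv.
have kn n : 0 < n.+2%:R^-1 :> R by rewrite invr_gt0.
have K01 n : K n `<=` `]0, 1[.
  move=> x; rewrite /K /= !in_itv/= => /andP[x1 x2].
  rewrite (lt_trans _ x1)//=; apply: (le_lt_trans x2).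
  by rewrite gtrDl oppr_lt0.
have agree n : mu (A `&` K n) = density_measure g (A `&` K n).
  pose nu := density_measure_canonical mg g0.
  change (mrestr mu (mK n) A = mrestr nu (mK n) A).
  refine (@measure_unique _ R _ (@ocitv R) (fun k => `](- k%:R), k%:R]%classic)
    erefl (@ocitvI R) _ _ (mrestr mu (mK n)) (mrestr nu (mK n)) _ _ A mA).
  - by move=> k; exists (- k%:R, k%:R).
  - apply/seteqP; split => // x _; exists (Num.truncn `|x|).+1 => //=.
    have := truncnS_gt `|x|; rewrite ltr_norml in_itv/= => /andP[-> /ltW ->].
    by [].
  - move=> _ [[x y] _ <-].
    change (mu (`]x, y] `&` K n) = density_measure g (`]x, y] `&` K n)).
    have -> : `]x, y] `&` K n =
        `](Num.max x n.+2%:R^-1), (Num.min y (1 - n.+2%:R^-1))]%classic.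
      apply/seteqP; split=> z; rewrite /K /= !in_itv/= gt_max le_min.
        by move=> [/andP[-> ->] /andP[-> ->]].
      by move=> /andP[/andP[-> ->] /andP[-> ->]].
    set x' := Num.max _ _; set y' := Num.min _ _.
    have x'0 : 0 < x' by rewrite lt_max kn orbT.
    have y'1 : y' < 1 by rewrite gt_min gtrDl oppr_lt0 kn orbT.
    have [xy'|yx'] := ltP x' y'; last first.
      by rewrite set_itv_ge ?bnd_simp -?leNgt// !measure0.
    rewrite gE ?H// => z /=; rewrite !in_itv/= => /andP[xz zy].
    by rewrite (lt_trans x'0)//= (le_lt_trans zy).
  - move=> k; apply: le_lt_trans mufin; apply: le_measure; rewrite ?inE//.
    exact: measurableI.
have KI : nondecreasing_seq (fun n => A `&` K n).
  apply/nondecreasing_seqP => n; apply/subsetPset; apply: setIS => x.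
  rewrite /K /= !in_itv/= => /andP[x1 x2].
  have nn : n.+3%:R^-1 <= n.+2%:R^-1 :> R by rewrite lef_pV2 ?posrE// ler_nat.
  by rewrite (le_lt_trans nn x1)/= (le_trans x2)// lerB.
have AK : \bigcup_n (A `&` K n) = A.
  rewrite -setI_bigcupr; apply/setIidPl => x /A01 /=; rewrite in_itv/=.
  move=> /andP[x0 x1].
  pose m := Num.min x (1 - x).
  have m0 : 0 < m by rewrite lt_min x0 subr_gt0.
  exists (Num.truncn m^-1) => //; rewrite /K /= in_itv/=.
  have : (Num.truncn m^-1).+2%:R^-1 < m.
    rewrite -[ltRHS]invrK ltf_pV2 ?posrE ?invr_gt0//.
    by apply: (lt_trans (truncnS_gt _)); rewrite ltr_nat.
  by rewrite lt_min => /andP[-> /ltW]/=; rewrite lerBrDl lerBrDr addrC.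
have cvg1 : mu (A `&` K n) @[n --> \oo] --> mu A.
  rewrite -[X in _ --> mu X]AK; apply: nondecreasing_cvg_mu => //.
  - by move=> n; exact: measurableI.
  - by rewrite AK.
have cvg2 : density_measure g (A `&` K n) @[n --> \oo] --> density_measure g A.
  rewrite -[X in _ --> density_measure g X]AK.
  apply: (nondecreasing_cvg_mu (mu := density_measure_canonical mg g0)) => //.
  - by move=> n; exact: measurableI.
  - by rewrite AK.
have E : (fun n => mu (A `&` K n)) = (fun n => density_measure g (A `&` K n)).
  exact/funext.
by apply: (cvg_unique _ cvg1) => //; rewrite E.
Qed.

End Densities.

(** * The law of the position *)

Lemma ae_le_measure {d} {Omega : measurableType d} {R : realType}
    (P : probability Omega R) (A B : set Omega) :
  measurable A -> measurable B -> {ae P, forall w, A w -> B w} -> (P A <= P B)%E.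
Proof.
move=> mA mB [N [mN N0 AB]].
have AN : A `<=` B `|` N.
  move=> w Aw; have [Bw|nBw] := pselect (B w); [by left|right].
  by apply: AB => /= /(_ Aw).
apply: (@le_trans _ _ (P (B `|` N))).
  by apply: le_measure; rewrite ?inE//; exact: measurableU.
by rewrite (le_trans (measureU2 _ mB mN))//= [X in (_ + X <= _)%E]N0 adde0.
Qed.

Section PositionLaw.
Context {d : measure_display} {Omega : measurableType d} {R : realType}.
Variable P : probability Omega R.
Variable X : R -> {RV P >-> R}.
Variable h : R.
Hypothesis X_ss : self_similar P h X.
Hypothesis X_si : stationary_increments P X.
Hypothesis X_reg : {ae P, forall w, regular_path (X ^~ w)}.

Let E (a L t : R) := [set w | prefix_sup t (samples X a L w)].

(** On (0,1) this is the distribution function of the relative position, but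
    this is known only once continuity has excluded atoms. *)
Definition position_cdf (t : R) := fine (P (E 0 1 t)).
Local Notation H := position_cdf.

Let mE a L t : measurable (E a L t).
Proof. exact: measurable_prefix_event. Qed.

Let subE a L s t : s <= t -> E a L s `<=` E a L t.
Proof. by move=> st w; exact: prefix_sup_le. Qed.

Let PE a L t : 0 < L -> P (E a L t) = (H t)%:E.
Proof.
move=> L0; rewrite fineK; first exact: (prefix_sup_law X_ss X_si).
exact: fin_num_measure.
Qed.

Let PED a L s t : 0 < L -> s <= t -> P (E a L t `\` E a L s) = (H t - H s)%:E.
Proof.
move=> L0 st; have fin : (P (E a L t) < +oo)%E by rewrite PE// ltry.
rewrite measureD// setIidr; last exact: subE.
by rewrite EFinB; congr (_ - _)%E; exact: PE.
Qed.

Lemma position_cdf_nd (s t : R) : s <= t -> H s <= H t.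
Proof.
move=> st; rewrite -lee_fin -!(@PE 0 1)//; apply: le_measure; rewrite ?inE//.
exact: subE.
Qed.

(** The event that the supremum over (0, 1) is first reached between t and
    t + L * r is compared, through [sup_before_subinterval], with the same event
    for the subinterval of length L starting at t - L * s. *)
Lemma position_cdf_scaling : scaling_increments H.
Proof.
move=> L s t r L0 s0 r0 sr1 Lst Lst'.
have Lr0 : 0 <= L * r by rewrite mulr_ge0// ltW.
rewrite -lee_fin -(@PED 0 1)//; last by rewrite lerDl.
rewrite -(@PED (t - L * s) L)//; last by rewrite lerDl.
apply: ae_le_measure; [exact: measurableD|exact: measurableD|].
apply: filterS X_reg => w Xw.
have Ls0 : 0 < L * s by rewrite mulr_gt0.
have Lsr : 0 < L * (1 - s - r) by rewrite mulr_gt0//; lra.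
have LsrE : L * (1 - s - r) = L - L * s - L * r by ring.
have LsE : L * (1 - s) = L - L * s by ring.
have t1 : t + L * r <= 1 by lra.
have e01 u : u <= 1 -> E 0 1 u w <-> sup_before (X ^~ w) 0 u 1.
  by move=> u1; have := prefix_sup_path 0 Xw ltr01 u1; rewrite mul1r !add0r.
have ecL u : u <= 1 -> E (t - L * s) L u w <->
    sup_before (X ^~ w) (t - L * s) (t - L * s + L * u) (t - L * s + L).
  by move=> u1; exact: prefix_sup_path.
move=> [/(e01 _ t1) Et nEt].
have t1' : t <= 1 by lra.
have {}nEt : ~ sup_before (X ^~ w) 0 t 1 by move=> /(e01 _ t1').
have [||||| Ey Ex] := @sup_before_subinterval _ (X ^~ w) 0 1
  (t - L * s) (t - L * s + L) t (t + L * r) _ _ _ _ _ Et nEt; [lra..|].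
have sr1' : s + r <= 1 by lra.
have s1' : s <= 1 by lra.
split.
- apply/(ecL _ sr1').
  by have -> : t - L * s + L * (s + r) = t + L * r by ring.
- move=> /(ecL _ s1').
  by have -> : t - L * s + L * s = t by ring.
Qed.

Let H_continuous t : 0 < t -> t < 1 -> {for t, continuous H}.
Proof.
move=> t0 t1; apply: scaling_continuous => //.
  by move=> x y _ _; exact: position_cdf_nd.
exact: position_cdf_scaling.
Qed.

Let mlt a L x : measurable [set w | prefix_position (samples X a L w) < x].
Proof.
rewrite (_ : [set w | _] =
  (fun w => prefix_position (samples X a L w)) @^-1` `]-oo, x[).
  by rewrite -[X in measurable X]setTI; exact: measurable_sampled_position.
by apply/seteqP; split=> w /=; rewrite in_itv.
Qed.

Let mle a L x : measurable [set w | prefix_position (samples X a L w) <= x].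
Proof.
rewrite (_ : [set w | _] =
  (fun w => prefix_position (samples X a L w)) @^-1` `]-oo, x]).
  by rewrite -[X in measurable X]setTI; exact: measurable_sampled_position.
by apply/seteqP; split=> w /=; rewrite in_itv.
Qed.

(** The event lies between the events defining H x and H q for every q < x, and
    H is continuous. *)
Lemma position_lt_law (a L x : R) : 0 < L -> 0 < x -> x < 1 ->
  P [set w | prefix_position (samples X a L w) < x] = (H x)%:E.
Proof.
move=> L0 x0 x1; apply/eqP; rewrite eq_le; apply/andP; split.
  rewrite -(@PE a L x)//; apply: le_measure; rewrite ?inE// => w /=.
  move=> /(prefix_position_lt _ (ltW x1))[i [ix]].
  by apply: prefix_sup_le; exact: ltW.
rewrite -[leRHS]fineK; last by apply: fin_num_measure.
rewrite lee_fin.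
have Hx : H q @[q --> x^'-] --> H x.
  by apply: cvg_at_left_filter; exact: H_continuous.
apply: (left_limit_le Hx x0) => q q0 qx.
rewrite -lee_fin [leRHS]fineK; last by apply: fin_num_measure.
rewrite -(@PE a L q)//; apply: le_measure; rewrite ?inE// => w Eq /=.
have [i /andP[qi ix]] := unit_rat_dense (ltW q0) qx (ltW x1).
apply/(prefix_position_lt _ (ltW x1)); exists i; split => //.
by apply: prefix_sup_le Eq; exact: ltW.
Qed.

Lemma position_le_law (a L x : R) : 0 < L -> 0 < x -> x < 1 ->
  P [set w | prefix_position (samples X a L w) <= x] = (H x)%:E.
Proof.
move=> L0 x0 x1; apply/eqP; rewrite eq_le; apply/andP; split; last first.
  rewrite -(@position_lt_law a L)//; apply: le_measure; rewrite ?inE// => w /=.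
  exact: ltW.
rewrite -[leLHS]fineK; last by apply: fin_num_measure.
rewrite lee_fin.
have Hx : H q @[q --> x^'+] --> H x.
  by apply: cvg_at_right_filter; exact: H_continuous.
apply: (cvgr_to_ge Hx); near=> q.
have xq : x < q by near: q; exact: nbhs_right_gt.
have q1 : q < 1 by near: q; exact: nbhs_right_lt.
rewrite -lee_fin [leLHS]fineK; last by apply: fin_num_measure.
rewrite -(@position_lt_law a L)//; last exact: lt_trans xq.
apply: le_measure; rewrite ?inE// => w /=.
by move=> /le_lt_trans; apply.
Unshelve. all: by end_near. Qed.

Lemma position_oc_law (a L x y : R) : 0 < L -> 0 < x -> x < y -> y < 1 ->
  P [set w | x < prefix_position (samples X a L w) <= y] = (H y - H x)%:E.
Proof.
move=> L0 x0 xy y1.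
have -> : [set w | x < prefix_position (samples X a L w) <= y] =
    [set w | prefix_position (samples X a L w) <= y] `\`
    [set w | prefix_position (samples X a L w) <= x].
  apply/seteqP; split=> w /=.
    by move=> /andP[xw wy]; split => //; apply/negP; rewrite -ltNge.
  by move=> [-> /negP]; rewrite -ltNge andbT.
rewrite measureD//; last exact: le_lt_trans (probability_le1 _ _) (ltry _).
rewrite setIidr; last by move=> w /= wx; apply: (le_trans wx); exact: ltW.
by rewrite EFinB; congr (_ - _)%E; apply: position_le_law => //; lra.
Qed.

Lemma position_oo_law (a L x y : R) : 0 < L -> 0 < x -> x < y -> y < 1 ->
  P [set w | x < prefix_position (samples X a L w) < y] = (H y - H x)%:E.
Proof.
move=> L0 x0 xy y1.
have -> : [set w | x < prefix_position (samples X a L w) < y] =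
    [set w | prefix_position (samples X a L w) < y] `\`
    [set w | prefix_position (samples X a L w) <= x].
  apply/seteqP; split=> w /=.
    by move=> /andP[xw wy]; split => //; apply/negP; rewrite -ltNge.
  by move=> [-> /negP]; rewrite -ltNge andbT.
rewrite measureD//; last exact: le_lt_trans (probability_le1 _ _) (ltry _).
rewrite setIidr; last by move=> w /= wx; exact: le_lt_trans xy.
rewrite EFinB; congr (_ - _)%E; first by apply: position_lt_law => //; lra.
by apply: position_le_law => //; lra.
Qed.

Lemma position_density : forall A : set R, measurable A -> A `<=` `]0, 1[ ->
  distribution P (sup_position_rv X 0 1) A =
  (\int[lebesgue_measure]_(t in A) (limit_slope H t)%:E)%E.
Proof.
have nd : {in `]0, 1[ &, {homo H : x y / x <= y}}.
  by move=> x y _ _; exact: position_cdf_nd.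
have sc := position_cdf_scaling.
apply: density_of_cdf.
- by change (P setT < +oo)%E; rewrite probability_setT ltry.
- exact: limit_slope_continuous.
- by move=> t; rewrite in_itv/= => /andP[t0 t1]; exact: limit_slope_ge0.
- move=> x y x0 xy y1; rewrite integral_limit_slope//.
  rewrite -EFinB -(@position_oc_law 0 1)//; congr (P _).
  apply/seteqP; split=> w /=;
    by rewrite /sup_position_rv /sup_position in_itv/= add0r mul1r.
Qed.

End PositionLaw.

(** The statement covers both intervals of interest: (a, a + L), where the
    conditions on the endpoints are void, and [a, a + L] for paths continuous at
    the endpoints. *)
Lemma leftmost_sup_position_regular {R : realType} (f : R -> R) (a L : R)
    (I : set R) :
  regular_path f -> 0 < L -> `]a, a + L[ `<=` I -> I `<=` `[a, a + L] ->
  (I a -> f @ a^'+ --> f a) -> (I (a + L) -> f @ (a + L)^'- --> f (a + L)) ->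
  leftmost_sup_position I f =
  a + L * prefix_position (fun i => f (a + L * unit_rat R i)).
Proof.
move=> freg L0 abI Iab fa fb.
apply: (leftmost_sup_positionE _ _ abI Iab fa fb) => //.
- exact: freg.1.
- by rewrite ltrDl.
- exact: position_ge.
- exact: position_le.
- by move=> q pq qb; apply: sup_before_after => //; exact: ltW.
- exact: not_sup_before_prior.
Qed.

Lemma cvg_inv_pinfty_right (R : realType) : T^-1 @[T --> +oo] --> (0 : R)^'+.
Proof.
move=> U [e /= e0 He]; change (\forall T \near +oo, U T^-1); near=> T.
have T0 : 0 < T by near: T; exact: (nbhs_pinfty_gt (num_real _)).
apply: He; last by rewrite /= invr_gt0.
rewrite /= sub0r normrN gtr0_norm ?invr_gt0// -[ltRHS]invrK ltf_pV2 ?posrE ?invr_gt0//.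
by near: T; exact: (nbhs_pinfty_gt (num_real _)).
Unshelve. all: by end_near. Qed.

Theorem theorem3 (R : realType) (d : measure_display) (Omega : measurableType d)
  (P : probability Omega R) (xi : R -> {RV P >-> R})
  (xi0 : {ae P, forall w, xi 0 w = 0})
  (xi_self_similar : exists2 h : R, 0 < h & self_similar P h xi)
  (xi_stationary : stationary_increments P xi)
  (xi_paths : {ae P, forall w, first_kind_discontinuities (fun t => xi t w)})
  (xi_separable : separable_process P xi) :
  exists (G : {RV P >-> R}) (psi : R -> R),
    {ae P, forall w, G w = leftmost_sup_position `[0, 1] (fun t => xi t w)} /\
    [/\ {in `]0, 1[, continuous psi},
        {in `]0, 1[, forall t, 0 <= psi t} &
        forall A : set R, measurable A -> A `<=` `]0, 1[ ->
          distribution P G A = (\int[lebesgue_measure]_(t in A) (psi t)%:E)%E] /\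
    {in `]0, 1[ &, forall t s,
      psi t <= psi s * Num.max (s / t) ((1 - s) / (1 - t))} /\
    ({in `]0, 1[, forall t, psi t = 0} \/ {in `]0, 1[, forall t, 0 < psi t}) /\
    (~ {in `]0, 1[, forall t, psi t = 0} ->
      forall a : R, a \in `]0, 1[ ->
      exists GT : R -> {RV P >-> R},
        (forall T : R, 0 < T ->
          {ae P, forall w, GT T w =
            leftmost_sup_position `](- T * a), (T * (1 - a))[
              (fun t => xi t w)}) /\
        exists2 o1 : R -> R, o1 T @[T --> +oo] --> 0 &
          forall T : R, 0 < T ->
            P [set w | `|GT T w| < 1] = (2 * psi a / T * (1 + o1 T))%:E).
Proof.
have [h h0 xi_ss] := xi_self_similar.
have reg := ae_regular_path h0 xi_ss xi_stationary xi_paths xi_separable.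
have right0 := ae_right_continuous h0 xi_ss xi_stationary xi_paths 0.
have left1 := ae_left_continuous h0 xi_ss xi_stationary xi_paths 1.
pose H := position_cdf xi.
have nd : {in `]0, 1[ &, {homo H : x y / x <= y}}.
  by move=> x y _ _; exact: (position_cdf_nd xi_ss xi_stationary).
have sc : scaling_increments H by exact: (position_cdf_scaling xi_ss xi_stationary reg).
pose psi := limit_slope H.
have psi_ge0 : {in `]0, 1[, forall t, 0 <= psi t}.
  by move=> t; rewrite in_itv/= => /andP[t0 t1]; exact: limit_slope_ge0.
have ratio : {in `]0, 1[ &, forall t s,
    psi t <= psi s * Num.max (s / t) ((1 - s) / (1 - t))}.
  move=> t s; rewrite !in_itv/= => /andP[t0 t1] /andP[s0 s1].
  exact: limit_slope_ratio.
have dicho : {in `]0, 1[, forall t, psi t = 0} \/ {in `]0, 1[, forall t, 0 < psi t}.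
  have [[s s01 s0]|nz] := pselect (exists2 s, s \in `]0, 1[ & psi s = 0).
    left => t t01; apply/eqP; rewrite eq_le psi_ge0// andbT.
    by have := ratio t s t01 s01; rewrite s0 mul0r.
  right => t t01; rewrite lt_neqAle psi_ge0// andbT eq_sym; apply/eqP => t0.
  by apply: nz; exists t.
exists (sup_position_rv xi 0 1), psi; split.
  apply: filterS3 reg right0 left1 => w xiw r0 l1.
  rewrite /sup_position_rv /= /sup_position; apply/esym.
  have := @leftmost_sup_position_regular _ (xi ^~ w) 0 1 `[0, 1]%classic xiw ltr01.
  rewrite add0r; apply => //.
  by apply: subset_itvW; rewrite ?bnd_simp.
split.
  split => //; first exact: limit_slope_continuous.
  exact: (position_density xi_ss xi_stationary reg).
do 2 split => //; move=> psi_n0 a a01.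
have psi_gt0 : 0 < psi a by case: dicho => [/psi_n0[]|]; exact.
move: (a01); rewrite in_itv/= => /andP[a0 a1].
exists (fun T => sup_position_rv xi (- T * a) T); split.
  move=> T T0; apply: filterS reg => w xiw.
  rewrite /sup_position_rv /= /sup_position; apply/esym.
  have TE : T * (1 - a) = - T * a + T by ring.
  rewrite TE; apply: leftmost_sup_position_regular => //.
  - exact: subset_itv_oo_cc.
  - by rewrite /= in_itv/= ltxx.
  - by rewrite /= in_itv/= ltxx andbF.
pose p T := fine (P [set w | `|sup_position_rv xi (- T * a) T w| < 1]).
exists (fun T => T * p T / (2 * psi a) - 1); last first.
  move=> T T0; rewrite -[LHS]fineK.
    by congr EFin; rewrite -/(p T); field; rewrite !gt_eqF.
  apply: fin_num_measure; rewrite (_ : [set _ | _] =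
    sup_position_rv xi (- T * a) T @^-1` `](-1), 1[).
    by rewrite -[X in measurable X]setTI; exact: measurable_funPT.
  by apply/seteqP; split => w /=; rewrite in_itv/= ltr_norml.
(* The identity is only eventual: (-1, 1) has to lie inside the interval. *)
have key : \forall T \near +oo,
    slope H (a - T^-1) (a + T^-1) / psi a - 1 = T * p T / (2 * psi a) - 1.
  near=> T.
  have T0 : 0 < T by near: T; exact: (nbhs_pinfty_gt (num_real _)).
  have Ta : T^-1 < a.
    rewrite -[ltRHS]invrK ltf_pV2 ?posrE ?invr_gt0//.
    by near: T; exact: (nbhs_pinfty_gt (num_real _)).
  have Ta' : T^-1 < 1 - a.
    rewrite -[ltRHS]invrK ltf_pV2 ?posrE ?invr_gt0 ?subr_gt0//.
    by near: T; exact: (nbhs_pinfty_gt (num_real _)).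
  have TV0 : 0 < T^-1 by rewrite invr_gt0.
  have pE : p T = H (a + T^-1) - H (a - T^-1).
    have <- : fine (H (a + T^-1) - H (a - T^-1))%:E = H (a + T^-1) - H (a - T^-1).
      by [].
    rewrite -(position_oo_law xi_ss xi_stationary reg (- T * a) T0); [|lra..].
    congr (fine (P _)); apply/seteqP; split => w /=;
      rewrite /sup_position_rv /sup_position ltr_norml;
      set q := prefix_position _.
      move=> /andP[q1 q2]; apply/andP; split.
        by rewrite -(ltr_pM2l T0) mulrBr divff ?gt_eqF//; move: q1; lra.
      by rewrite -(ltr_pM2l T0) mulrDr divff ?gt_eqF//; move: q2; lra.
    rewrite -(ltr_pM2l T0) mulrBr divff ?gt_eqF// => /andP[q1].
    rewrite -(ltr_pM2l T0) mulrDr divff ?gt_eqF// => q2.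
    by apply/andP; split; lra.
  rewrite pE /slope; congr (_ - _).
  have -> : a + T^-1 - (a - T^-1) = 2 / T by field; rewrite gt_eqF.
  by field; rewrite !gt_eqF.
have lim0 :
    slope H (a - T^-1) (a + T^-1) / psi a - 1 @[T --> +oo] --> psi a / psi a - 1.
  apply: cvgB; last exact: cvg_cst.
  apply: cvgM; last exact: cvg_cst.
  exact: (cvg_comp _ _ (@cvg_inv_pinfty_right R) (cvg_symmetric_slope nd sc a0 a1)).
rewrite divff ?gt_eqF// subrr in lim0.
exact: (cvg_trans (near_eq_cvg key) lim0).
Unshelve. all: by end_near. Qed.
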